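(* Let $G=\mathbb{R}\rtimes_\alpha\mathbb{R}_+^\times$, $\alpha_a x=ax$, be the $ax+b$-group with the involution $\tau(x,a)=(-x,a)$. Every unitary representation $(\pi^c,\mathcal{H})$ of $G$ (identified with its $c$-dual group $G^c$) with $-i\,\mathtt{d}\pi^c(1,0)\ge0$ has a euclidean realization.
   Context: A reflection positive Hilbert space is a triple $(\mathcal{E},\mathcal{E}_+,\theta)$, where $\mathcal{E}$ is a complex Hilbert space, $\theta$ a unitary involution on $\mathcal{E}$ and $\mathcal{E}_+\subseteq\mathcal{E}$ a closed subspace with $\langle\theta v,v\rangle\ge0$ for $v\in\mathcal{E}_+$. $\widehat{\mathcal{E}}$ is the Hilbert completion of $\mathcal{E}_+/\{v\in\mathcal{E}_+:\langle\theta v,v\rangle=0\}$ with respect to $\|\widehat v\|=\sqrt{\langle\theta v,v\rangle}$, $q:\mathcal{E}_+\to\widehat{\mathcal{E}}$, $v\mapsto\widehat v$, is the canonical map, and for an operator $T$ on $\mathcal{E}_+$ preserving the null space of $q$ (on its domain), $\widehat T$ is defined by $\widehat T\widehat v=\widehat{Tv}$. Let $(G,H,\tau)$ be a symmetric Lie group ($\tau$ an involutive automorphism of the Lie group $G$, $H$ an open subgroup of $G^\tau$), with $\mathfrak{g}=\mathfrak{h}\oplus\mathfrak{q}$ the decomposition of its Lie algebra into $\pm1$-eigenspaces of $\tau$; $\mathfrak{g}^c=\mathfrak{h}\oplus i\mathfrak{q}\subseteq\mathfrak{g}_{\mathbb{C}}$ and $G^c$ is the simply connected Lie group with Lie algebra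 $\mathfrak{g}^c$. A unitary representation $\pi$ of $G$ on $\mathcal{E}$ (with derived representation $\mathtt{d}\pi$ on the space $\mathcal{E}^\infty$ of smooth vectors) is reflection positive on $(\mathcal{E},\mathcal{E}_+,\theta)$ if (RP1) $\pi(\tau(g))=\theta\pi(g)\theta$ for $g\in G$; (RP2) $\pi(h)\mathcal{E}_+=\mathcal{E}_+$ for $h\in H$; (RP3) there is a subspace $\mathcal{D}\subseteq\mathcal{E}_+\cap\mathcal{E}^\infty$, dense in $\mathcal{E}_+$, with $\mathtt{d}\pi(x)\mathcal{D}\subseteq\mathcal{D}$ for all $x\in\mathfrak{q}$. Then $h\mapsto\widehat{\pi(h)}$ is a unitary representation of $H$ on $\widehat{\mathcal{E}}$, and on the dense subspace $\widehat{\mathcal{D}}=q(\mathcal{D})$ one has the operators $\beta(x+iy):=\widehat{\mathtt{d}\pi(x)}-i\,\widehat{\mathtt{d}\pi(y)}$, $x\in\mathfrak{h}$, $y\in\mathfrak{q}$. If this infinitesimally unitary representation $\beta$ of $\mathfrak{g}^c$ integrates to a unitary representation $\pi^c$ of $G^c$ on $\widehat{\mathcal{E}}$ (so that $\mathtt{d}\pi^c(z)$ extends $\beta(z)$ for $z\in\mathfrak{g}^c$), compatible with the representation $h\mapsto\widehat{\pi(h)}$ of $H$, then $(\pi,\mathcal{E})$ is called a euclidean realization of $(\pi^c,\widehat{\mathcal{E}})$, and of every unitary representation of $G^c$ unitarily equivalent to it. For the $ax+b$-group: $H=\{0\}\times\mathbb{R}_+^\times$, $\mathfrak{g}=\mathbb{R}\times\mathbb{R}$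 with $\mathfrak{q}=\mathbb{R}\times\{0\}$, $\mathfrak{h}=\{0\}\times\mathbb{R}$, and the Lie algebra isomorphism $\mathfrak{g}\to\mathfrak{g}^c$, $(t,x)\mapsto(it,x)$, is used to identify $G^c$ with $G$. The condition $-i\,\mathtt{d}\pi^c(1,0)\ge0$ says that the self-adjoint generator $B$ of the translation group, $\pi^c(t,1)=e^{itB}$, is positive. *)

(* Defs.v *)
From HB Require Import structures.
From mathcomp Require Import all_boot all_order all_algebra.
From mathcomp Require Import sesquilinear complex ring.
From mathcomp Require Import all_classical all_reals all_analysis.
Set Implicit Arguments.
Unset Strict Implicit.
Unset Printing Implicit Defensive.
Import Order.TTheory GRing.Theory Num.Theory.
Import numFieldNormedType.Exports.
Local Open Scope classical_set_scope.
Local Open Scope complex_scope.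
Local Open Scope ring_scope.

(** Complex Hilbert spaces; inner products are linear in the first argument. *)

Record hilbert (R : realType) := Hilbert {
  hilbert_sort :> completeNormedModType R[i];
  inner : {dot hilbert_sort for Num.conj};
  hilbert_normE : forall v, `|v| ^+ 2 = inner v v
}.

Definition is_subspace (R : realType) (E : hilbert R) (S : set E) : Prop :=
  S 0 /\ forall (c : R[i]) (v w : E), S v -> S w -> S (c *: v + w).

Definition unitary_op (R : realType) (E F : hilbert R) (U : E -> F) : Prop :=
  [/\ linear U,
      forall v w, inner F (U v) (U w) = inner E v w &
      forall w, exists v, U v = w].

(** The ax+b group: [Axb t a] is the affine map x |-> a x + t. *)

Record axb (R : realType) := Axb { transl : R; dilat : {posnum R} }.
Arguments Axb {R} transl dilat.

Section AxbGroup.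
Context {R : realType}.

Definition pair_of_axb (g : axb R) : R * {posnum R} := (transl g, dilat g).
Definition axb_of_pair (p : R * {posnum R}) : axb R := Axb p.1 p.2.

Lemma pair_of_axbK : cancel pair_of_axb axb_of_pair.
Proof. by case. Qed.

HB.instance Definition _ := Choice.copy (axb R) (can_type pair_of_axbK).

Definition axb_mul (g h : axb R) : axb R :=
  Axb (transl g + (dilat g)%:num * transl h)
      ((dilat g)%:num * (dilat h)%:num)%:pos.
Definition axb_one : axb R := Axb 0 1%:pos.
Definition axb_inv (g : axb R) : axb R :=
  Axb (- ((dilat g)%:num^-1 * transl g)) ((dilat g)%:num^-1)%:pos.

Lemma axb_eq (g h : axb R) :
  transl g = transl h -> (dilat g)%:num = (dilat h)%:num -> g = h.
Proof. by case: g h => [t a] [u b] /= -> ab; congr Axb; exact: val_inj. Qed.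

Lemma axb_mulA : associative axb_mul.
Proof.
by move=> g h k; apply: axb_eq; rewrite /= ?mulrA // mulrDr addrA mulrA.
Qed.

Lemma axb_mul1g : left_id axb_one axb_mul.
Proof. by move=> g; apply: axb_eq; rewrite /= ?mul1r// add0r. Qed.

Lemma axb_mulg1 : right_id axb_one axb_mul.
Proof. by move=> g; apply: axb_eq; rewrite /= ?mulr1// mulr0 addr0. Qed.

Lemma axb_mulVg : left_inverse axb_one axb_inv axb_mul.
Proof.
by move=> g; apply: axb_eq; rewrite /= ?mulVf ?gt_eqF// addNr.
Qed.

Lemma axb_mulgV : right_inverse axb_one axb_inv axb_mul.
Proof.
by move=> g; apply: axb_eq; rewrite /= ?mulfV ?gt_eqF// mulrN mulVKf ?subrr// gt_eqF.
Qed.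

HB.instance Definition _ := isGroup.Build (axb R)
  axb_mulA axb_mul1g axb_mulg1 axb_mulVg axb_mulgV.

Definition axb_tau (g : axb R) : axb R := Axb (- transl g) (dilat g).

(* The global chart (t, s) |-> (t, e^s), a diffeomorphism from R^2 onto
   R x ]0, +oo[; it carries the topology and the smooth structure of the
   group. *)
Definition axb_chart (p : R * R) : axb R := Axb p.1 (PosNum (expR_gt0 p.2)).

(* The exponential map of the Lie algebra R x R: [axb_exp (t, x)] is the
   exponential of the matrix with rows (x, t) and (0, 0). *)
Definition axb_exp (X : R * R) : axb R :=
  Axb (if X.2 == 0 then X.1 else X.1 * ((expR X.2 - 1) / X.2))
      (PosNum (expR_gt0 X.2)).

Lemma axb_expD (s r : R) (X : R * R) :
  axb_exp ((s + r) * X.1, (s + r) * X.2) =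
  axb_mul (axb_exp (s * X.1, s * X.2)) (axb_exp (r * X.1, r * X.2)).
Proof.
case: X => t x; apply: axb_eq => /=; last by rewrite mulrDl expRD.
have [->|x0] := eqVneq x 0.
  by rewrite !mulr0 eqxx expR0 mul1r mulrDl.
have E u : (if u * x == 0 then u * t else u * t * ((expR (u * x) - 1) / (u * x)))
    = t * ((expR (u * x) - 1) / x).
  have [->|u0] := eqVneq u 0; first by rewrite !mul0r eqxx expR0 subrr mul0r mulr0.
  by rewrite (negbTE (mulf_neq0 u0 x0)); field; rewrite u0 x0.
by rewrite !E (mulrDl s r x) expRD; field.
Qed.

End AxbGroup.

(** Functions of class C^n and C^oo from R^2 to a complex normed space. The
    scalars of the target being R[i], the derivative of the library, which
    takes source and target over the same field, does not apply. *)

Section Smooth.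
Context {R : realType} {V : normedModType R[i]}.

Definition diffquot (f : R * R -> V) (p u : R * R) (h : R) : V :=
  (h%:C)^-1 *: (f (p.1 + h * u.1, p.2 + h * u.2) - f p).

Definition has_pderiv (f : R * R -> V) (u : R * R) : Prop :=
  forall p, cvg (diffquot f p u h @[h --> 0^']).

Definition pderiv (u : R * R) (f : R * R -> V) : R * R -> V :=
  fun p => lim (diffquot f p u h @[h --> 0^']).

Fixpoint class_C (n : nat) (f : R * R -> V) : Prop :=
  continuous f /\
  (if n is m.+1 then
     [/\ has_pderiv f (1, 0), has_pderiv f (0, 1),
         class_C m (pderiv (1, 0) f) & class_C m (pderiv (0, 1) f)]
   else True).

Definition smooth (f : R * R -> V) : Prop := forall n, class_C n f.

End Smooth.

Section Representations.
Context {R : realType}.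

Definition unitary_rep (E : hilbert R) (pi : axb R -> E -> E) : Prop :=
  [/\ forall g, unitary_op (pi g),
      forall v, pi 1%g v = v,
      forall g h v, pi (g * h)%g v = pi g (pi h v) &
      forall v, continuous (fun p => pi (axb_chart p) v)].

Definition unitarily_equivalent (E F : hilbert R)
    (pi : axb R -> E -> E) (rho : axb R -> F -> F) : Prop :=
  exists2 U : E -> F, unitary_op U & forall g v, U (pi g v) = rho g (U v).

Definition smooth_vector (E : hilbert R) (pi : axb R -> E -> E) : set E :=
  [set v | smooth (fun p => pi (axb_chart p) v)].

Definition orbit_quot (E : hilbert R) (pi : axb R -> E -> E) (X : R * R)
    (v : E) (s : R) : E :=
  (s%:C)^-1 *: (pi (axb_exp (s * X.1, s * X.2)) v - v).

(* The derivative of s |-> pi(exp(sX)) at 0. It is meaningful on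
   [dpi_dom pi X], the domain of the generator of this one-parameter group,
   which contains the smooth vectors; elsewhere [lim] is unspecified. *)
Definition dpi_dom (E : hilbert R) (pi : axb R -> E -> E) (X : R * R) : set E :=
  [set v | cvg (orbit_quot pi X v s @[s --> 0^'])].

Definition dpi (E : hilbert R) (pi : axb R -> E -> E) (X : R * R) (v : E) : E :=
  lim (orbit_quot pi X v s @[s --> 0^']).

(* -i dpi(1,0) >= 0, stated for the self-adjoint generator B of the
   translations, pi(t,1) = e^{itB}, on the whole domain of B. *)
Definition positive_energy (E : hilbert R) (pi : axb R -> E -> E) : Prop :=
  forall v, dpi_dom pi (1, 0) v ->
    0 <= inner E (- 'i%C *: dpi pi (1, 0) v) v.

Definition reflection_positive_space (E : hilbert R) (Eplus : set E)
    (theta : E -> E) : Prop :=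
  [/\ unitary_op theta, involutive theta,
      is_subspace Eplus, closed Eplus &
      forall v, Eplus v -> 0 <= inner E (theta v) v].

(* [q : Eplus -> Ehat] exhibits Ehat as the Hilbert completion of
   Eplus / {v | <theta v, v> = 0} for the norm sqrt <theta v, v>; the values
   of q outside Eplus are irrelevant. *)
Definition is_hilbert_completion (E : hilbert R) (Eplus : set E)
    (theta : E -> E) (Ehat : hilbert R) (q : E -> Ehat) : Prop :=
  [/\ forall (c : R[i]) v w, Eplus v -> Eplus w ->
        q (c *: v + w) = c *: q v + q w,
      forall v, Eplus v -> `|q v| = sqrtC (inner E (theta v) v) &
      dense (q @` Eplus)].

Definition RP1 (E : hilbert R) (theta : E -> E) (pi : axb R -> E -> E) : Prop :=
  forall g v, pi (axb_tau g) v = theta (pi g (theta v)).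

(* H = {0} x ]0, +oo[ *)
Definition RP2 (E : hilbert R) (Eplus : set E) (pi : axb R -> E -> E) : Prop :=
  forall a : {posnum R}, pi (Axb 0 a) @` Eplus = Eplus.

(* The condition (RP3) for a given domain D; q = R x {0}. *)
Definition RP3 (E : hilbert R) (Eplus : set E) (pi : axb R -> E -> E)
    (D : set E) : Prop :=
  [/\ is_subspace D, D `<=` Eplus `&` smooth_vector pi, Eplus `<=` closure D &
      forall (t : R) v, D v -> D (dpi pi (t, 0) v)].

Definition reflection_positive_rep (E : hilbert R) (Eplus : set E)
    (theta : E -> E) (pi : axb R -> E -> E) (D : set E) : Prop :=
  [/\ reflection_positive_space Eplus theta, unitary_rep pi,
      RP1 theta pi, RP2 Eplus pi & RP3 Eplus pi D].

(* The vector beta(z) (q v), v in D, for the element z = (0,x) + i(t,0) of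
   g^c, which is identified with (t,x) in g. *)
Definition beta (E Ehat : hilbert R) (q : E -> Ehat) (pi : axb R -> E -> E)
    (z : R * R) (v : E) : Ehat :=
  q (dpi pi (0, z.2) v) - 'i%C *: q (dpi pi (z.1, 0) v).

(* The representation beta of g^c on q(D) integrates to the representation
   pihat of G^c = G: for all z, the operator dpihat(z) on the smooth vectors of
   pihat extends beta(z), and pihat restricts on H to h |-> \hat{pi(h)}. *)
Definition integrates_to (E Ehat : hilbert R) (Eplus D : set E)
    (q : E -> Ehat) (pi : axb R -> E -> E) (pihat : axb R -> Ehat -> Ehat)
    : Prop :=
  [/\ unitary_rep pihat,
      forall v, D v -> smooth_vector pihat (q v),
      forall z v, D v -> dpi pihat z (q v) = beta q pi z v &
      forall (a : {posnum R}) v, Eplus v ->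
        pihat (Axb 0 a) (q v) = q (pi (Axb 0 a) v)].

Definition has_euclidean_realization (H : hilbert R) (pic : axb R -> H -> H)
    : Prop :=
  exists (E : hilbert R) (Eplus : set E) (theta : E -> E)
         (pi : axb R -> E -> E) (D : set E),
    reflection_positive_rep Eplus theta pi D /\
    exists (Ehat : hilbert R) (q : E -> Ehat) (pihat : axb R -> Ehat -> Ehat),
      [/\ is_hilbert_completion Eplus theta q,
          integrates_to Eplus D q pi pihat &
          unitarily_equivalent pihat pic].

End Representations.

(* Main.v *)
Require Import Defs.
From HB Require Import structures.
From mathcomp Require Import all_boot all_order all_algebra.
From mathcomp Require Import sesquilinear complex ring lra.
From mathcomp Require Import all_classical all_reals all_analysis.
Set Implicit Arguments.
Unset Strict Implicit.
Unset Printing Implicit Defensive.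
Import Order.TTheory GRing.Theory Num.Theory.
Import numFieldNormedType.Exports.
Local Open Scope classical_set_scope.
Local Open Scope complex_scope.
Local Open Scope ring_scope.

(** The realization has Ehat = H and pihat equal to the given representation
    pic, and lives on the Hilbert sum E of countably many copies of H, on whose
    i-th copy (t, a) acts by pic (s_i t, a), where the s_i are real nodes that
    come in pairs of opposite numbers. The generator of the translations of E is
    thus s_i A on the i-th copy, A being that of pic. To turn it into an
    imaginary multiple of A, as the passage to the dual group requires, the
    nodes are averaged with complex weights w_i for which

      sum_i w_i s_i^k = (-i)^k     for all k >= 0,

    the series converging absolutely: although all nodes are real, the weights
    behave on polynomials like a unit mass at the point -i ([weight_moment]).
    They are obtained from the zeros 2^n of the entire function
    prod_(n >= 0) (1 - 2^-n z), whose Taylor coefficients annihilate all powers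
    at these points ([moments_vanish]): an affine change of variable moves the
    point 1 to -1 and the others to numbers r_n >= 1, so that a unit mass at -1
    has the same moments as a family of weights at the r_n; the nodes are the
    two square roots of each r_n.

    Write w_i = m_i d_i^2 with d_i > 0 and m_i of modulus 1. Opposite nodes have
    conjugate weights, so that exchanging the copies of s and -s and multiplying
    by m_i is a unitary involution theta; it reverses the translations and fixes
    the dilations. For x in H put T_k x = (d_i s_i^k x)_i ([embed]). The moments
    yield

      <theta (T_j x), T_k y> = <i^j x, i^k y>      ([pairing_embed]),

    so that on the span D of the T_k x, for x in a subspace W of H, the form
    <theta u, u> is the squared norm of q u, where q (T_k x) = i^k x ([qmap]).
    It is thus nonnegative on the closure E_+ of D, and q identifies the
    completion with the closure of W.

    For W one takes the vectors to which the two generators of pic can be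
    applied indefinitely ([core]), which are dense by Garding's argument
    ([core_dense]): integrals of the orbits against smooth functions of compact
    support. The generator of the translations of E maps T_k x to T_(k+1) (A x),
    and q (T_(k+1) (A x)) = i^(k+1) A x, so that q intertwines it on D with i A
    ([dom_intertwined]); the dilations commute with q. This says that
    beta (z) = dpic (z). As D is invariant under both generators, its vectors
    are smooth ([invariant_smooth]). *)

(** * Complex normed spaces measured by real numbers *)

Section RealNorm.
Context {R : realType}.

Lemma normc_real (r : R) : `|r%:C| = `|r|%:C :> R[i].
Proof. by rewrite normc_def /= expr0n addr0 sqrtr_sqr. Qed.

(** The norm of a complex normed space takes its values in R[i]; estimates are
    made with its real part, which carries the same information. *)
Definition rnorm (V : normedZmodType R[i]) (v : V) : R := complex.Re `|v|.

Context {V : normedModType R[i]}.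
Implicit Types (v w : V).

Lemma rnormE v : `|v| = (rnorm v)%:C.
Proof.
rewrite /rnorm; have : `|v| \is Num.real by exact: normr_real.
by case: `|v| => a b /complex_realP[c [-> ->]].
Qed.

Lemma rnorm_ge0 v : 0 <= rnorm v.
Proof. by rewrite -lecR -rnormE normr_ge0. Qed.

Lemma rnorm0 : rnorm (0 : V) = 0.
Proof. by rewrite /rnorm normr0. Qed.

Lemma rnorm0_eq0 v : rnorm v = 0 -> v = 0.
Proof. by move=> v0; apply/normr0_eq0; rewrite rnormE v0. Qed.

Lemma rnormD v w : rnorm (v + w) <= rnorm v + rnorm w.
Proof. by rewrite -lecR rmorphD/= -!rnormE ler_normD. Qed.

Lemma rnormN v : rnorm (- v) = rnorm v.
Proof. by rewrite /rnorm normrN. Qed.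

Lemma rnormB v w : rnorm (v - w) = rnorm (w - v).
Proof. by rewrite -rnormN opprB. Qed.

Lemma ler_rnormB v w : rnorm (v - w) <= rnorm v + rnorm w.
Proof. by rewrite (le_trans (rnormD _ _))// rnormN. Qed.

Lemma rnormBB v w u : rnorm (v - w) <= rnorm (v - u) + rnorm (u - w).
Proof. by apply: le_trans (rnormD _ _); rewrite addrA subrK. Qed.

Lemma ler_dist_rnorm v w : `|rnorm v - rnorm w| <= rnorm (v - w).
Proof.
rewrite ler_norml; apply/andP; split.
  by have := rnormD v (w - v); rewrite addrC subrK (rnormB w); lra.
by have := rnormD w (v - w); rewrite addrC subrK; lra.
Qed.

Lemma rnormZ (c : R[i]) v : rnorm (c *: v) = complex.Re `|c| * rnorm v.
Proof.
rewrite {1}/rnorm normrZ (rnormE v).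
by case: `|c| => a b /=; rewrite mulr0 subr0.
Qed.

Lemma rnormZr (r : R) v : rnorm (r%:C *: v) = `|r| * rnorm v.
Proof. by rewrite rnormZ normc_real. Qed.

Lemma rnorm_sum (I : Type) (s : seq I) (P : pred I) (f : I -> V) :
  rnorm (\sum_(i <- s | P i) f i) <= \sum_(i <- s | P i) rnorm (f i).
Proof.
elim/big_rec2: _ => [|i x y Pi xy]; first by rewrite rnorm0.
by rewrite (le_trans (rnormD _ _))// lerD2l.
Qed.

Lemma cvg_rnormP (T : Type) (F : set_system T) (FF : Filter F) (f : T -> V) (l : V) :
  f @ F --> l <-> forall e : R, 0 < e -> \forall x \near F, rnorm (f x - l) < e.
Proof.
split=> [/cvgrPdist_lt fl e e0|fl].
  have := fl e%:C; rewrite ltcR => /(_ e0).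
  by apply: filterS => x; rewrite rnormE ltcR rnormB.
apply/cvgrPdist_lt => -[a b]; rewrite ltcE/= => /andP[/eqP-> a0].
have := fl a a0; apply: filterS => x; by rewrite rnormE -rnormB ltcR.
Qed.

Lemma cvg_rnorm0P (T : Type) (F : set_system T) (FF : Filter F) (f : T -> V) (l : V) :
  f @ F --> l <-> rnorm (f x - l) @[x --> F] --> (0 : R).
Proof.
rewrite cvg_rnormP; split=> [fl|/cvgrPdist_lt fl e e0].
  apply/cvgrPdist_lt => e /fl; apply: filterS => x.
  by rewrite sub0r normrN ger0_norm ?rnorm_ge0.
have := fl e e0; apply: filterS => x.
by rewrite sub0r normrN ger0_norm ?rnorm_ge0.
Qed.

Lemma cvg_rnorm (T : Type) (F : set_system T) (FF : Filter F) (f : T -> V) (l : V) :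
  f @ F --> l -> rnorm (f x) @[x --> F] --> rnorm l.
Proof.
move=> /cvg_rnormP fl; apply/cvgrPdist_lt => e /fl; apply: filterS => x.
by apply: le_lt_trans; rewrite distrC ler_dist_rnorm.
Qed.

Lemma cvgZ_real (T : Type) (F : set_system T) (FF : Filter F) (a : T -> R) (b : R)
    (f : T -> V) (l : V) :
  a @ F --> b -> f @ F --> l -> (a x)%:C *: f x @[x --> F] --> b%:C *: l.
Proof.
move=> ab fl.
apply: (cvgZ (s := fun x => (a x)%:C) (k := (b%:C : R[i]^o))) fl.
apply/cvgrPdist_lt => -[c d]; rewrite ltcE/= => /andP[/eqP-> c0].
move/cvgrPdist_lt: ab => /(_ c c0); apply: filterS => x.
by rewrite -rmorphB/= normc_real ltcR.
Qed.

End RealNorm.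

Lemma cvg_sqr (R : realType) (T : Type) (F : set_system T) (FF : Filter F) (g : T -> R) (l : R) :
  g @ F --> l -> g x ^+ 2 @[x --> F] --> l ^+ 2.
Proof.
move=> gl; exact: (@cvg_comp _ _ _ g (fun x => x ^+ 2) _ _ _ gl (@exprn_continuous R 2%N l)).
Qed.

Section RealNormHilbert.
Context {R : realType} {H : hilbert R}.
Implicit Types v w : H.

Lemma inner_rnorm v : inner H v v = (rnorm v ^+ 2)%:C.
Proof. by rewrite -hilbert_normE rnormE rmorphXn. Qed.

End RealNormHilbert.

(** * Absolutely summable families indexed by nat * bool *)

Section PairSeries.
Context {R : realType}.
Implicit Types f g : nat * bool -> R.

(** The two values of the second component are taken together because they will
    index a node s and its opposite -s, which the reflection exchanges. *)
Definition pairsum (V : nmodType) (f : nat * bool -> V) (n : nat) : V :=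
  f (n, true) + f (n, false).

Definition summable f : Prop := cvgn (series (pairsum f)).

Definition total f : R := limn (series (pairsum f)).

Lemma pairsum_ge0 f n : (forall i, 0 <= f i) -> 0 <= pairsum f n.
Proof. by move=> f0; rewrite addr_ge0. Qed.

Lemma pairsumD (V : nmodType) (f g : nat * bool -> V) :
  pairsum (fun i => f i + g i) = (fun n => pairsum f n + pairsum g n).
Proof. by apply/funext => n; rewrite /pairsum addrACA. Qed.

Lemma pairsumZr (c : R) f : pairsum (fun i => c * f i) = (fun n => c * pairsum f n).
Proof. by apply/funext => n; rewrite /pairsum mulrDr. Qed.

Lemma total_ext f g : (forall i, f i = g i) -> total f = total g.
Proof. by move=> fg; rewrite (_ : f = g)//; apply/funext. Qed.

Lemma summable_ext f g : (forall i, f i = g i) -> summable f -> summable g.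
Proof. by move=> fg; rewrite (_ : f = g)//; apply/funext. Qed.

Lemma summable0 : summable (fun=> 0).
Proof.
rewrite /summable (_ : series _ = cst 0); first exact: is_cvg_cst.
apply/funext => n; rewrite /series/= big1// => i _.
by rewrite /pairsum addr0.
Qed.

Lemma summableD f g : summable f -> summable g -> summable (fun i => f i + g i).
Proof. by move=> sf sg; rewrite /summable pairsumD; exact: is_cvg_seriesD. Qed.

Lemma totalD f g : summable f -> summable g ->
  total (fun i => f i + g i) = total f + total g.
Proof. by move=> sf sg; rewrite /total pairsumD; exact: lim_seriesD. Qed.

Lemma summableZ (c : R) f : summable f -> summable (fun i => c * f i).
Proof. by move=> sf; rewrite /summable pairsumZr; exact: is_cvg_seriesZ. Qed.

Lemma totalZ (c : R) f : summable f -> total (fun i => c * f i) = c * total f.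
Proof. by move=> sf; rewrite /total pairsumZr; exact: lim_seriesZ. Qed.

Lemma summableB f g : summable f -> summable g -> summable (fun i => f i - g i).
Proof.
move=> sf sg; apply: (@summable_ext (fun i => f i + (-1) * g i)).
  by move=> i; rewrite mulN1r.
by apply: summableD => //; exact: summableZ.
Qed.

Lemma summable_le f g : (forall i, 0 <= f i <= g i) -> summable g -> summable f.
Proof.
move=> fg; apply: series_le_cvg => n.
- by apply: pairsum_ge0 => i; have /andP[] := fg i.
- by apply: pairsum_ge0 => i; have /andP[f0 /(le_trans f0)] := fg i.
- by rewrite lerD//; [have /andP[] := fg (n, true) | have /andP[] := fg (n, false)].
Qed.

Lemma summable_abs f g : (forall i, `|f i| <= g i) -> summable g -> summable f.
Proof.
move=> fg sg; have sa : summable (fun i => `|f i|).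
  by apply: summable_le sg => i; rewrite normr_ge0 fg.
apply: normed_cvg; apply: series_le_cvg sa => n.
- exact: normr_ge0.
- by apply: pairsum_ge0 => i; exact: normr_ge0.
- exact: ler_normD.
Qed.

Lemma total_le f g : (forall i, f i <= g i) -> summable f -> summable g ->
  total f <= total g.
Proof. by move=> fg sf sg; apply: lim_series_le => // n; rewrite lerD. Qed.

Lemma partial_le_total f n : (forall i, 0 <= f i) -> summable f ->
  series (pairsum f) n <= total f.
Proof.
move=> f0 sf; apply: (nondecreasing_cvgn_le _ sf).
by apply: nondecreasing_series => k _ _; exact: pairsum_ge0.
Qed.

Lemma total_ge0 f : (forall i, 0 <= f i) -> summable f -> 0 <= total f.
Proof. by move=> f0 /(partial_le_total 0 f0); rewrite /series/= big_geq. Qed.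

Lemma term_le_total f i : (forall i, 0 <= f i) -> summable f -> f i <= total f.
Proof.
move=> f0 sf; apply: le_trans (partial_le_total i.1.+1 f0 sf).
rewrite seriesSr; apply: (@le_trans _ _ (pairsum f i.1)).
  by case: i => n [] /=; rewrite /pairsum ?lerDl ?lerDr.
by rewrite lerDr sumr_ge0// => k _; exact: pairsum_ge0.
Qed.

Lemma summable_bounded f (M : R) : (forall i, 0 <= f i) ->
  (forall n, series (pairsum f) n <= M) -> summable f /\ total f <= M.
Proof.
move=> f0 fM; have sf : summable f.
  apply: nondecreasing_is_cvgn.
    by apply: nondecreasing_series => k _ _; exact: pairsum_ge0.
  by exists M => _ [n _ <-].
by split=> //; apply: limr_le => //; exact: nearW.
Qed.

Definition flip (i : nat * bool) : nat * bool := (i.1, ~~ i.2).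

Lemma flipK : involutive flip.
Proof. by case=> n b; rewrite /flip/= negbK. Qed.

Lemma pairsum_flip (V : nmodType) (f : nat * bool -> V) :
  pairsum (fun i => f (flip i)) = pairsum f.
Proof. by apply/funext => n; rewrite /pairsum/= addrC. Qed.

Lemma summable_flip f : summable f -> summable (fun i => f (flip i)).
Proof. by rewrite /summable pairsum_flip. Qed.

Lemma total_flip f : total (fun i => f (flip i)) = total f.
Proof. by rewrite /total pairsum_flip. Qed.

(** Beyond a finite number of indices the dominating family has a small
    total, and there are finitely many indices before. *)
Lemma total_dominated (T : Type) (F : set_system T) (FF : Filter F)
    (f : T -> nat * bool -> R) g : (forall i, 0 <= g i) ->
  (forall x i, 0 <= f x i <= g i) -> summable g ->
  (forall i, f x i @[x --> F] --> 0) -> total (f x) @[x --> F] --> 0.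
Proof.
move=> g0 fg sg f0; have f_ge0 x i : 0 <= f x i by have /andP[] := fg x i.
have sf x : summable (f x) by exact: summable_le (fg x) sg.
have tail x N : total (f x) <= series (pairsum (f x)) N
    + (total g - series (pairsum g) N).
  have gf i : 0 <= g i - f x i by rewrite subr_ge0; have /andP[] := fg x i.
  have := partial_le_total N gf (summableB sg (sf x)).
  rewrite (_ : total _ = total g - total (f x)); last first.
    rewrite -(mulN1r (total (f x))) -totalZ// -totalD//; last exact: summableZ.
    by apply: total_ext => i; rewrite mulN1r.
  rewrite (_ : series _ N = series (pairsum g) N - series (pairsum (f x)) N); last first.
    rewrite /series/= -sumrB; apply: eq_bigr => k _.
    by rewrite /pairsum opprD addrACA.
  lra.
have head N : series (pairsum (f x)) N @[x --> F] --> 0.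
  elim: N => [|N IH].
    rewrite (_ : (fun x => _) = cst 0); first exact: cvg_cst.
    by apply/funext => x; rewrite /series/= big_geq.
  rewrite (_ : (fun x => _) =
      (fun x => series (pairsum (f x)) N + (f x (N, true) + f x (N, false)))).
    have f2 : f x (N, true) + f x (N, false) @[x --> F] --> 0 + 0 by exact: cvgD.
    by rewrite -(addr0 0) -[in X in _ --> _ + X](addr0 0); exact: cvgD IH f2.
  by apply/funext => x; rewrite seriesSr.
apply/cvgrPdist_lt => e e0.
have [N _ gN] : \forall N \near \oo, `|total g - series (pairsum g) N| < e / 2.
  by move/cvgrPdist_lt : sg; apply; rewrite divr_gt0.
have {gN} := gN N (leqnn N) => gN.
have := head N => /cvgrPdist_lt /(_ (e / 2)); rewrite divr_gt0// => /(_ isT).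
apply: filterS => x; rewrite !sub0r !normrN => fN.
rewrite ger0_norm ?total_ge0// (le_lt_trans (tail x N))//.
by move: gN fN; rewrite !ltr_norml => /andP[_ gN] /andP[_ fN]; lra.
Qed.

End PairSeries.

Arguments summableZ {R} c {f}.
Arguments totalZ {R} c {f}.

(** * Complex series and inner products *)

Section ComplexTotal.
Context {R : realType}.
Implicit Types h : nat * bool -> R[i].

Definition csummable h : Prop :=
  summable (fun i => complex.Re (h i)) /\ summable (fun i => complex.Im (h i)).

Definition ctotal h : R[i] :=
  total (fun i => complex.Re (h i)) +i* total (fun i => complex.Im (h i)).

Lemma ctotal_ext h h' : (forall i, h i = h' i) -> ctotal h = ctotal h'.
Proof. by move=> hh'; rewrite (_ : h = h')//; apply/funext. Qed.

Lemma ctotalD h h' : csummable h -> csummable h' ->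
  ctotal (fun i => h i + h' i) = ctotal h + ctotal h'.
Proof.
move=> [hr hi] [hr' hi']; rewrite /ctotal; apply/eqP; rewrite eq_complex /=.
by rewrite -!totalD//; apply/andP; split; apply/eqP/total_ext => i; rewrite raddfD.
Qed.

Lemma csummableZ (c : R[i]) h : csummable h -> csummable (fun i => c * h i).
Proof.
move: c => [a b] [hr hi]; split.
  have := summableB (summableZ a hr) (summableZ b hi).
  by apply: summable_ext => i; case: (h i).
have := summableD (summableZ a hi) (summableZ b hr).
by apply: summable_ext => i; case: (h i).
Qed.

Lemma ctotalZ (c : R[i]) h : csummable h -> ctotal (fun i => c * h i) = c * ctotal h.
Proof.
move: c => [a b] [hr hi]; rewrite /ctotal; simpc; congr (_ +i* _).
  rewrite -[b * _]opprK -mulNr -!totalZ// opprK -totalD; last 2 first.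
  - exact: summableZ.
  - exact: summableZ.
  by apply: total_ext => i; case: (h i) => ? ?; simpc => /=; rewrite ?mulNr.
rewrite -!totalZ// -totalD; last 2 first.
- exact: summableZ.
- exact: summableZ.
by apply: total_ext => i; case: (h i) => ? ?; simpc.
Qed.

Lemma ctotal_conj h : csummable h -> ctotal (fun i => (h i)^*)%C = (ctotal h)^*%C.
Proof.
move=> [hr hi]; rewrite /ctotal; apply/eqP; rewrite eq_complex/=; apply/andP; split.
  by apply/eqP/total_ext => i; case: (h i).
by rewrite -mulN1r -totalZ//; apply/eqP/total_ext => i; case: (h i) => ? ? /=; rewrite mulN1r.
Qed.

Lemma ctotal_flip h : ctotal (fun i => h (flip i)) = ctotal h.
Proof.
by rewrite /ctotal (total_flip (fun i => complex.Re (h i)))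
  (total_flip (fun i => complex.Im (h i))).
Qed.

Lemma ctotal_real (f : nat * bool -> R) : ctotal (fun i => (f i)%:C) = (total f)%:C.
Proof.
rewrite /ctotal /=; congr (_ +i* _); rewrite /total (_ : series _ = cst 0); last first.
  apply/funext => n; rewrite /series/= big1// => i _; by rewrite /pairsum addr0.
exact: lim_cst.
Qed.

Lemma Re_le_norm (z : R[i]) : `|complex.Re z| <= complex.Re `|z|.
Proof. by have := normc_ge_Re z; rewrite lecE => /andP[]. Qed.

Lemma Im_le_norm (z : R[i]) : `|complex.Im z| <= complex.Re `|z|.
Proof.
have := Re_le_norm (z * 'i%C); rewrite ReiNIm normrN normrM.
by rewrite -[in X in _ -> X](mulr1 `|z|) (_ : `|'i%C| = 1)// normc_def/= expr0n expr1n add0r sqrtr1.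
Qed.

Lemma csummable_abs h g : (forall i, complex.Re `|h i| <= g i) -> summable g ->
  csummable h.
Proof.
by move=> hg sg; split; apply: summable_abs sg => i; apply: le_trans (hg i);
  [exact: Re_le_norm|exact: Im_le_norm].
Qed.

End ComplexTotal.

Section InnerEstimates.
Context {R : realType} {H : hilbert R}.
Implicit Types v w : H.

Lemma inner_conj v w : inner H v w = (inner H w v)^*%C.
Proof. by rewrite [LHS](@hermC _ _ _ _ (inner H)) expr0 mul1r. Qed.

Lemma innerDl u v w : inner H (u + v) w = inner H u w + inner H v w.
Proof. exact: linearDl. Qed.

Lemma innerDr u v w : inner H u (v + w) = inner H u v + inner H u w.
Proof. exact: linearDr. Qed.

Lemma innerZl (c : R[i]) v w : inner H (c *: v) w = c * inner H v w.
Proof. exact: linearZl_LR. Qed.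

Lemma innerZr (c : R[i]) v w : inner H v (c *: w) = c^*%C * inner H v w.
Proof. by rewrite inner_conj innerZl rmorphM/= -inner_conj. Qed.

Lemma Re_inner v w :
  rnorm (v + w) ^+ 2 = rnorm v ^+ 2 + rnorm w ^+ 2 + complex.Re (inner H v w) *+ 2.
Proof.
apply: (@complexI R).
rewrite -inner_rnorm innerDl !innerDr [inner H w v]inner_conj !inner_rnorm.
set x := rnorm v ^+ 2; set y := rnorm w ^+ 2.
case: (inner H v w) => a b; apply/eqP; rewrite eq_complex /=.
by apply/andP; split; apply/eqP; rewrite ?mulr2n; ring.
Qed.

Lemma abs_Re_inner v w :
  `|complex.Re (inner H v w)| <= (rnorm v ^+ 2 + rnorm w ^+ 2) / 2.
Proof.
have := Re_inner v w; have := Re_inner (- v) w.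
have := sqr_ge0 (rnorm (v + w)); have := sqr_ge0 (rnorm (- v + w)).
rewrite rnormN -scaleN1r innerZl mulN1r raddfN/= ler_norml.
move: (rnorm (v + w) ^+ 2) (rnorm (-1 *: v + w) ^+ 2) (rnorm v ^+ 2).
move: (rnorm w ^+ 2) (complex.Re _) => a b x y c y0 x0 ey ex; move: ex ey x0 y0.
by move=> -> -> ? ?; apply/andP; split; lra.
Qed.

Lemma abs_Im_inner v w :
  `|complex.Im (inner H v w)| <= (rnorm v ^+ 2 + rnorm w ^+ 2) / 2.
Proof.
have := abs_Re_inner ('i%C *: v) w; rewrite innerZl mulrC ReiNIm normrN rnormZ.
by rewrite (_ : `|'i%C| = 1) ?mul1r// normc_def/= expr0n expr1n add0r sqrtr1.
Qed.

End InnerEstimates.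

(** * The Hilbert sum of copies of a Hilbert space indexed by nat * bool *)

Section HilbertSum.
Context {R : realType} (H : hilbert R).
Implicit Types f g : nat * bool -> H.

Definition sqnorms f (i : nat * bool) : R := rnorm (f i) ^+ 2.

Definition sqsummable : pred (nat * bool -> H) :=
  fun f => `[< summable (sqnorms f) >].

Lemma sqnorms_ge0 f i : 0 <= sqnorms f i.
Proof. exact: sqr_ge0. Qed.

Lemma sqr_rnormD_le (v w : H) (a b : R) : 0 < a -> 0 < b ->
  rnorm (v + w) ^+ 2 <=
  (1 + b / a) * rnorm v ^+ 2 + (1 + a / b) * rnorm w ^+ 2.
Proof.
move=> a0 b0; apply: (@le_trans _ _ ((rnorm v + rnorm w) ^+ 2)).
  by rewrite lerXn2r ?nnegrE ?addr_ge0 ?rnorm_ge0 ?rnormD.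
move: (rnorm v) (rnorm w) => x y; rewrite -subr_ge0.
rewrite (_ : _ - _ = (b * x - a * y) ^+ 2 / (a * b)).
  by rewrite divr_ge0 ?sqr_ge0 ?mulr_ge0 ?ltW.
by field; rewrite !gt_eqF.
Qed.

Lemma sqr_rnormD2 (v w : H) :
  rnorm (v + w) ^+ 2 <= 2 * rnorm v ^+ 2 + 2 * rnorm w ^+ 2.
Proof.
by have := sqr_rnormD_le v w (@ltr01 R) (@ltr01 R); rewrite divr1 -[1 + 1]/(2 : R).
Qed.

Lemma sqnormsZ (c : R[i]) f i :
  sqnorms (c *: f) i = complex.Re `|c| ^+ 2 * sqnorms f i.
Proof. by rewrite /sqnorms -exprMn -rnormZ. Qed.

Lemma sqsummable_submod : submod_closed sqsummable.
Proof.
split=> [|c f g /asboolP sf /asboolP sg]; apply/asboolP.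
  by apply: (summable_ext _ (@summable0 R)) => i; rewrite /sqnorms rnorm0 expr0n.
apply: (@summable_le _ _ (fun i => (2 * complex.Re `|c| ^+ 2) * sqnorms f i
    + 2 * sqnorms g i)); last by apply: summableD; exact: summableZ.
move=> i; rewrite sqnorms_ge0/= (le_trans (sqr_rnormD2 _ _))//.
by rewrite lerD2r -mulrA ler_wpM2l// -sqnormsZ.
Qed.

HB.instance Definition _ := GRing.isSubmodClosed.Build _ _ sqsummable
  sqsummable_submod.

Record l2 := L2 { l2_val :> nat * bool -> H; l2_subproof : l2_val \in sqsummable }.

HB.instance Definition _ := [isSub for l2_val].
HB.instance Definition _ := [Choice of l2 by <:].
HB.instance Definition _ := [SubChoice_isSubLmodule of l2 by <:].

Implicit Types u v w : l2.

Lemma l2_eq u v : (forall i, u i = v i) -> u = v.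
Proof. by move=> uv; apply: val_inj; apply/funext. Qed.

Lemma l2_summable u : summable (sqnorms u).
Proof. by case: u => f sf; apply/asboolP. Qed.

Arguments l2_summable : clear implicits.

Lemma l2_DE u v i : (u + v) i = u i + v i. Proof. by []. Qed.
Lemma l2_BE u v i : (u - v) i = u i - v i. Proof. by []. Qed.
Lemma l2_ZE (c : R[i]) u i : (c *: u) i = c *: u i. Proof. by []. Qed.

Definition sqnorm u : R := total (sqnorms u).

Lemma sqnorm_ge0 u : 0 <= sqnorm u.
Proof. exact: total_ge0 (sqnorms_ge0 u) (l2_summable u). Qed.

Lemma sqnorm_coord u i : rnorm (u i) ^+ 2 <= sqnorm u.
Proof. exact: term_le_total (sqnorms_ge0 u) (l2_summable u). Qed.

Lemma sqnorm_eq0 u : sqnorm u = 0 -> u = 0.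
Proof.
move=> u0; apply: l2_eq => i; apply: rnorm0_eq0; apply/eqP.
by rewrite -sqrf_eq0 eq_le sqr_ge0 andbT -u0 sqnorm_coord.
Qed.

Lemma sqnormZ (c : R[i]) u : sqnorm (c *: u) = complex.Re `|c| ^+ 2 * sqnorm u.
Proof.
rewrite -(totalZ _ (l2_summable u)); apply: total_ext => i; exact: sqnormsZ.
Qed.

Definition l2_norm u : R[i] := (Num.sqrt (sqnorm u))%:C.

(** Minkowski's inequality, by summing the pointwise bound of
    [sqr_rnormD_le] with a and b the norms of the two terms. *)
Lemma l2_normD u v : l2_norm (u + v) <= l2_norm u + l2_norm v.
Proof.
rewrite /l2_norm -rmorphD lecR.
have [->|u0] := eqVneq u 0.
  by rewrite add0r lerDr sqrtr_ge0.
have [->|v0] := eqVneq v 0.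
  by rewrite addr0 lerDl sqrtr_ge0.
have gt0 w : w != 0 -> 0 < Num.sqrt (sqnorm w).
  by move=> w0; rewrite sqrtr_gt0 lt0r sqnorm_ge0 andbT; apply: contraNN w0 => /eqP/sqnorm_eq0->.
set a := Num.sqrt (sqnorm u); set b := Num.sqrt (sqnorm v).
have a0 : 0 < a by exact: gt0.
have b0 : 0 < b by exact: gt0.
have ab0 : 0 <= a + b by rewrite addr_ge0// ltW.
rewrite -(ger0_norm ab0) -[leRHS]sqrtr_sqr ler_wsqrtr//.
have -> : (a + b) ^+ 2 = (1 + b / a) * sqnorm u + (1 + a / b) * sqnorm v.
  rewrite -(sqr_sqrtr (sqnorm_ge0 u)) -(sqr_sqrtr (sqnorm_ge0 v)) -/a -/b.
  by field; rewrite !gt_eqF.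
rewrite /sqnorm -!totalZ; try exact: l2_summable; rewrite -totalD; last 2 first.
- exact: summableZ (l2_summable u).
- exact: summableZ (l2_summable v).
apply: total_le => [i||]; first exact: sqr_rnormD_le.
- exact: l2_summable.
- by apply: summableD; apply: summableZ; exact: l2_summable.
Qed.

Lemma l2_normZ (c : R[i]) u : l2_norm (c *: u) = `|c| * l2_norm u.
Proof.
have c0 : 0 <= complex.Re `|c| by rewrite -lecR (RRe_real (normr_real c)) normr_ge0.
rewrite /l2_norm sqnormZ sqrtrM ?sqr_ge0// sqrtr_sqr ger0_norm// rmorphM.
by congr (_ * _); exact: RRe_real (normr_real _).
Qed.

Lemma l2_norm_eq0 u : l2_norm u = 0 -> u = 0.
Proof.
move=> /(@complexI R)/eqP; rewrite sqrtr_eq0 => u0.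
by apply: sqnorm_eq0; apply/eqP; rewrite eq_le u0 sqnorm_ge0.
Qed.

HB.instance Definition _ := Lmodule_isNormed.Build R[i] l2
  l2_normD l2_normZ l2_norm_eq0.

Lemma l2_rnorm u : rnorm u = Num.sqrt (sqnorm u).
Proof. by []. Qed.

Lemma l2_rnorm_sq u : rnorm u ^+ 2 = sqnorm u.
Proof. by rewrite l2_rnorm sqr_sqrtr// sqnorm_ge0. Qed.

Lemma l2_coord_le u i : rnorm (u i) <= rnorm u.
Proof.
by rewrite -[leLHS]ger0_norm ?rnorm_ge0// -sqrtr_sqr l2_rnorm ler_wsqrtr// sqnorm_coord.
Qed.

End HilbertSum.

Arguments l2_summable {R H} u.

Section HilbertSumComplete.
Context {R : realType} {H : hilbert R}.
Implicit Types u v w : l2 H.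

(** The limit is taken coordinatewise; the partial sums of the squared norms
    pass to the limit, which bounds the whole series. *)
Lemma l2_complete (F : set_system (l2 H)) : ProperFilter F -> cauchy F -> cvg F.
Proof.
move=> FF Fc.
have small e : 0 < e -> exists u : l2 H, \forall v \near F, rnorm (v - u) < e.
  move=> e0; have /cauchyP/(_ e%:C) := Fc.
  rewrite ltcR => /(_ e0)[u uF]; exists u.
  move: uF; apply: filterS => v; rewrite -ball_normE/= rnormE ltcR.
  by rewrite rnormB.
pose l i : H := lim ((fun v : l2 H => v i) @ F).
have Fl i : (fun v : l2 H => v i) @ F --> l i.
  apply: (@cauchy_cvg _ ((fun v : l2 H => v i) @ F)).
  apply/cauchyP => -[e c]; rewrite ltcE/= => /andP[/eqP-> e0].
  have [u uF] := small e e0; exists (u i).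
  rewrite nbhs_simpl/=; move: uF; apply: filterS => v.
  rewrite -ball_normE/= rnormE ltcR rnormB; apply: le_lt_trans.
  by rewrite -l2_BE l2_coord_le.
have close e : 0 < e -> exists2 u : l2 H, (\forall v \near F, rnorm (v - u) < e) &
    summable (sqnorms (fun i => l i - u i)) /\
    total (sqnorms (fun i => l i - u i)) <= e ^+ 2.
  move=> e0; have [u uF] := small e e0; exists u => //.
  apply: summable_bounded => [i|n]; first exact: sqnorms_ge0.
  have Fs : (fun v : l2 H => series (pairsum (sqnorms (fun i => v i - u i))) n) @ F -->
      series (pairsum (sqnorms (fun i => l i - u i))) n.
    have Fi i : (fun v : l2 H => sqnorms (fun i => v i - u i) i) @ F -->
        sqnorms (fun i => l i - u i) i.
      rewrite /sqnorms; apply: (cvgM (f := fun v : l2 H => rnorm (v i - u i)));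
        by apply: cvg_rnorm; apply: cvgB => //; exact: cvg_cst.
    elim: n => [|n IH].
      rewrite (_ : (fun v => _) = cst 0); last first.
        by apply/funext => v; rewrite /series/= big_geq.
      by rewrite /series/= big_geq//; exact: cvg_cst.
    rewrite seriesSr (_ : (fun v => _) = (fun v : l2 H =>
      series (pairsum (sqnorms (fun i => v i - u i))) n +
      pairsum (sqnorms (fun i => v i - u i)) n)); last first.
      by apply/funext => v; rewrite seriesSr.
    by apply: cvgD => //; rewrite /pairsum; exact: cvgD.
  apply: (closed_cvg (fun x => x <= e ^+ 2)) Fs; first exact: closed_le.
  move: uF; apply: filterS => v vu.
  apply: (@le_trans _ _ (sqnorm (v - u))).
    exact: (partial_le_total n (sqnorms_ge0 (v - u)) (l2_summable (v - u))).
  by rewrite -l2_rnorm_sq lerXn2r ?nnegrE ?rnorm_ge0 ?ltW.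
have [u0 _ [su0 _]] := close 1 ltr01.
have sl : l \in @sqsummable R H.
  rewrite (_ : l = (fun i => l i - u0 i) + u0); last first.
    by apply/funext => i; rewrite [RHS]subrK.
  by apply: rpredD; [apply/asboolP|exact: l2_subproof].
apply/cvg_ex; exists (L2 sl).
apply/(@cvg_rnormP _ _ _ F _ id) => e e0.
have e20 : 0 < e / 2 by rewrite divr_gt0.
have [u uF [_ lu]] := close _ e20.
move: uF; apply: filterS => v vu.
apply: le_lt_trans (rnormBB _ _ u) _.
suff : rnorm (u - L2 sl) <= e / 2 by move: vu; lra.
rewrite rnormB l2_rnorm -(ger0_norm (ltW e20)) -sqrtr_sqr; exact: ler_wsqrtr.
Qed.

HB.instance Definition _ := Uniform_isComplete.Build (l2 H) l2_complete.

Definition l2_inner u v : R[i] := ctotal (fun i => inner H (u i) (v i)).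

Lemma l2_inner_csummable u v : csummable (fun i => inner H (u i) (v i)).
Proof.
have s := summableZ 2^-1 (summableD (l2_summable u) (l2_summable v)).
by split; apply: summable_abs s => i; rewrite mulrC;
  [exact: abs_Re_inner|exact: abs_Im_inner].
Qed.

Lemma l2_inner_conj u v : l2_inner u v = (l2_inner v u)^*%C.
Proof.
rewrite /l2_inner -ctotal_conj; last exact: l2_inner_csummable.
by apply: ctotal_ext => i; exact: inner_conj.
Qed.

Lemma l2_inner_linearl v : linear_for *%R (l2_inner^~ v).
Proof.
move=> c u w; rewrite /l2_inner -ctotalZ; last exact: l2_inner_csummable.
rewrite -ctotalD; last 2 first.
- by apply: csummableZ; exact: l2_inner_csummable.
- exact: l2_inner_csummable.
by apply: ctotal_ext => i; rewrite innerDl innerZl.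
Qed.

Lemma l2_inner_linearr u : linear_for (Num.conj \; *%R) (l2_inner u).
Proof.
move=> c v w; rewrite l2_inner_conj l2_inner_linearl rmorphD rmorphM.
by rewrite [l2_inner u v]l2_inner_conj [l2_inner u w]l2_inner_conj.
Qed.

Lemma l2_innerE u : l2_inner u u = (sqnorm u)%:C.
Proof. by rewrite -ctotal_real; apply: ctotal_ext => i; exact: inner_rnorm. Qed.

HB.instance Definition _ := bilinear_isBilinear.Build R[i] (l2 H) (l2 H) R[i]
  *%R (Num.conj \; *%R) l2_inner (l2_inner_linearl, l2_inner_linearr).

Lemma l2_inner_hermitian u v :
  l2_inner u v = (-1) ^+ false * Num.conj (l2_inner v u).
Proof. by rewrite expr0 mul1r l2_inner_conj. Qed.

HB.instance Definition _ := isHermitianSesquilinear.Build R[i] (l2 H)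
  false Num.conj l2_inner l2_inner_hermitian.

Lemma l2_inner_gt0 u : u != 0 -> 0 < l2_inner u u.
Proof.
rewrite l2_innerE ltcR lt0r sqnorm_ge0 andbT; apply: contraNN => /eqP.
by move/sqnorm_eq0->.
Qed.

HB.instance Definition _ := isDotProduct.Build R[i] (l2 H) l2_inner l2_inner_gt0.

Lemma l2_normE u : `|u| ^+ 2 = l2_inner u u.
Proof. by rewrite l2_innerE rnormE -rmorphXn/= l2_rnorm_sq. Qed.

End HilbertSumComplete.

Definition l2_hilbert (R : realType) (H : hilbert R) : hilbert R :=
  @Hilbert R (l2 H) (@l2_inner R H) (@l2_normE R H).

Section HilbertSumConvergence.
Context {R : realType} {H : hilbert R}.

Lemma l2_dominated (T : Type) (F : set_system T) (FF : Filter F)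
    (f : T -> l2 H) (u : l2 H) (g : nat * bool -> R) :
  (forall x i, rnorm (f x i - u i) ^+ 2 <= g i) -> summable g ->
  (forall i, f x i @[x --> F] --> u i) -> f @ F --> u.
Proof.
move=> fg sg fu; apply/(@cvg_rnorm0P R (l2 H)).
have s0 : sqnorm (f x - u) @[x --> F] --> 0.
  have [[x0 _]|noT] := pselect (exists x : T, True); last first.
    apply/cvgrPdist_lt => e e0; apply: (@filterS _ _ _ setT); last exact: filterT.
    by move=> x; have : False by apply: noT; exists x.
  have g_ge0 i : 0 <= g i by apply: le_trans (fg x0 i); exact: sqr_ge0.
  apply: (@total_dominated _ _ _ _ (fun x => sqnorms (f x - u)) g) => //.
    by move=> x i; rewrite sqnorms_ge0; exact: fg.
  move=> i; have /cvg_rnorm0P fi := fu i.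
  by rewrite -[X in _ --> X](mulr0 0); exact: (cvgM fi fi).
rewrite (_ : (fun x => _) = (fun x => Num.sqrt (sqnorm (f x - u))))//.
rewrite -(@sqrtr0 R).
by apply: (cvg_comp _ _ s0); exact: sqrt_continuous.
Qed.

End HilbertSumConvergence.

(** * Generators of representations of the ax+b group *)

Section RepCalculus.
Context {R : realType} {E : hilbert R} (pi : axb R -> E -> E).
Context (hpi : unitary_rep pi).
Implicit Types u v w a c : E.

Lemma rep_linear g : linear (pi g).
Proof. by case: hpi => h _ _ _; case: (h g). Qed.

Lemma rep_mul g h v : pi g (pi h v) = pi (axb_mul g h) v.
Proof. by case: hpi => _ _ m _; rewrite -m. Qed.

Lemma rep_one v : pi axb_one v = v.
Proof. by case: hpi => _ h _ _; exact: h. Qed.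

Lemma repD g v w : pi g (v + w) = pi g v + pi g w.
Proof. by have := rep_linear g 1 v w; rewrite !scale1r. Qed.

Lemma rep0 g : pi g 0 = 0.
Proof. by have := repD g 0 0; rewrite addr0 => /esym/eqP; rewrite -subr_eq0 addrK => /eqP. Qed.

Lemma repZ g (x : R[i]) v : pi g (x *: v) = x *: pi g v.
Proof. by have := rep_linear g x v 0; rewrite !addr0 rep0 addr0. Qed.

Lemma repB g v w : pi g (v - w) = pi g v - pi g w.
Proof. by rewrite repD -scaleN1r repZ scaleN1r. Qed.

Lemma rep_inner g v w : inner E (pi g v) (pi g w) = inner E v w.
Proof. by case: hpi => h _ _ _; case: (h g). Qed.

Lemma rep_rnorm g v : rnorm (pi g v) = rnorm v.
Proof.
apply/eqP; rewrite -(@eqrXn2 _ 2) ?rnorm_ge0//; apply/eqP/(@complexI R).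
by rewrite -!inner_rnorm rep_inner.
Qed.

Lemma rep_cvg (T : Type) (F : set_system T) (FF : Filter F)
    (p : T -> R * R) (q : R * R) (f : T -> E) v :
  p @ F --> q -> f @ F --> v ->
  pi (axb_chart (p x)) (f x) @[x --> F] --> pi (axb_chart q) v.
Proof.
move=> pq fv; have [_ _ _ cont] := hpi.
have c1 : pi (axb_chart (p x)) v @[x --> F] --> pi (axb_chart q) v.
  exact: (@cvg_comp _ _ _ p (fun r => pi (axb_chart r) v) _ _ _ pq (cont v q)).
move/cvg_rnormP : c1 => c1; move/cvg_rnormP : fv => fv.
apply/cvg_rnormP => e e0; near=> x.
apply: le_lt_trans (rnormBB _ _ (pi (axb_chart (p x)) v)) _.
rewrite -repB rep_rnorm.
have /= : rnorm (f x - v) < e / 2 by near: x; apply: fv; rewrite divr_gt0.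
have /= : rnorm (pi (axb_chart (p x)) v - pi (axb_chart q) v) < e / 2.
  by near: x; apply: c1; rewrite divr_gt0.
by lra.
Unshelve. all: by end_near. Qed.

Lemma rep_continuous (T : Type) (F : set_system T) (FF : Filter F) g
    (f : T -> E) v : f @ F --> v -> pi g (f x) @[x --> F] --> pi g v.
Proof.
move/cvg_rnormP => fv; apply/cvg_rnormP => e /fv; apply: filterS => x.
by rewrite -repB rep_rnorm.
Qed.

Definition transop (t : R) v : E := pi (axb_chart (t, 0)) v.

Definition dilop (s : R) v : E := pi (axb_chart (0, s)) v.

Lemma chartE p v : pi (axb_chart p) v = transop p.1 (dilop p.2 v).
Proof.
rewrite /transop /dilop rep_mul; congr (pi _ v).
by apply: axb_eq; rewrite /= ?mulr0 ?addr0// expR0 mul1r.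
Qed.

Lemma transopD t r v : transop (t + r) v = transop t (transop r v).
Proof.
rewrite /transop rep_mul; congr (pi _ v).
by apply: axb_eq; rewrite /= expR0 mul1r.
Qed.

Lemma dilopD s r v : dilop (s + r) v = dilop s (dilop r v).
Proof.
rewrite /dilop rep_mul; congr (pi _ v).
by apply: axb_eq; rewrite /= ?mulr0 ?addr0// expRD.
Qed.

Lemma dilop_transop s t v : dilop s (transop t v) = transop (expR s * t) (dilop s v).
Proof.
rewrite /dilop /transop !rep_mul; congr (pi _ v).
by apply: axb_eq; rewrite /= ?mulr0 ?addr0 ?add0r// expR0 mulr1 mul1r.
Qed.

Lemma transop0 v : transop 0 v = v.
Proof.
rewrite /transop -[RHS]rep_one; congr (pi _ v).
by apply: axb_eq; rewrite /= ?expR0.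
Qed.

Lemma dilop0 v : dilop 0 v = v. Proof. exact: transop0. Qed.

(** [genA v a] and [genC v c] say that v is in the domain of the generator of
    the translations, resp. of the dilations, and give its value. *)
Definition genA v a : Prop :=
  (t%:C)^-1 *: (transop t v - v) @[t --> (0 : R)^'] --> a.

Definition genC v c : Prop :=
  (s%:C)^-1 *: (dilop s v - v) @[s --> (0 : R)^'] --> c.

Lemma gen_unique (f : R -> E) a a' :
  f @ (0 : R)^' --> a -> f @ (0 : R)^' --> a' -> a = a'.
Proof. by move=> fa fa'; apply: (cvg_unique _ fa fa'); exact: norm_hausdorff. Qed.

Lemma genZD (f : R -> E -> E) (x : R[i]) v w a a' : (forall t, linear (f t)) ->
  (t%:C)^-1 *: (f t v - v) @[t --> (0 : R)^'] --> a ->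
  (t%:C)^-1 *: (f t w - w) @[t --> (0 : R)^'] --> a' ->
  (t%:C)^-1 *: (f t (x *: v + w) - (x *: v + w)) @[t --> (0 : R)^'] --> x *: a + a'.
Proof.
move=> lf va wa.
rewrite (_ : (fun t => _) = (fun t : R => x *: ((t%:C)^-1 *: (f t v - v)) +
    (t%:C)^-1 *: (f t w - w))); last first.
  apply/funext => t; rewrite lf scalerA [x * _]mulrC -scalerA -scalerDr.
  by congr (_ *: _); rewrite scalerBr opprD addrACA.
by apply: cvgD => //; exact: cvgZl_tmp.
Qed.

Lemma transop_linear t : linear (transop t). Proof. exact: rep_linear. Qed.
Lemma dilop_linear s : linear (dilop s). Proof. exact: rep_linear. Qed.

End RepCalculus.

Arguments rep_cvg {R E pi} hpi {T F FF p q f v} _ _.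
Arguments rep_continuous {R E pi} hpi {T F FF} g {f v} _.

Section Cores.
Context {R : realType} {E : hilbert R} (pi : axb R -> E -> E).
Context (hpi : unitary_rep pi).
Implicit Types u v w a c : E.

Lemma near_dnbhs0_neq : \forall t \near (0 : R)^', t != 0.
Proof. exact: nbhs_dnbhs_neq. Qed.

Lemma cvg_dnbhs0_scale (k : R) : k != 0 -> k * t @[t --> (0 : R)^'] --> (0 : R)^'.
Proof.
move=> k0 A /nbhs_ballP[e e0 eA]; apply/nbhs_ballP; exists (e / `|k|) => /=.
  by rewrite divr_gt0// normr_gt0.
move=> t; rewrite /ball/= sub0r normrN ltr_pdivlMr ?normr_gt0// => te t0.
by apply: eA; rewrite /ball/= ?sub0r ?normrN ?normrM 1?mulrC// mulf_neq0.
Qed.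

Lemma cvg_dnbhs0_id : t @[t --> (0 : R)^'] --> (0 : R).
Proof. exact: cvg_within. Qed.

Lemma genA_dilop s v a : genA pi v a ->
  genA pi (dilop pi s v) ((expR (- s))%:C *: dilop pi s a).
Proof.
move=> va.
have k0 : expR (- s) != 0 by rewrite gt_eqF// expR_gt0.
have va' : ((expR (- s) * t)%:C)^-1 *: (transop pi (expR (- s) * t) v - v)
    @[t --> (0 : R)^'] --> a.
  exact: (cvg_comp (fun t => expR (- s) * t)
    (fun t => (t%:C)^-1 *: (transop pi t v - v)) (cvg_dnbhs0_scale k0) va).
rewrite /genA (_ : (fun t => _) = (fun t : R => (expR (- s))%:C *: dilop pi s
   (((expR (- s) * t)%:C)^-1 *: (transop pi (expR (- s) * t) v - v)))).
  by apply: cvgZl_tmp; exact: (rep_continuous hpi (axb_chart (0, s)) va').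
apply/funext => t; rewrite /dilop (repZ hpi) (repB hpi) -!/(dilop pi s _).
rewrite (dilop_transop hpi) mulrA -expRD subrr expR0 mul1r scalerA.
by rewrite rmorphM/= invfM mulrA divff ?mul1r// -(rmorph0 (real_complex R)) (inj_eq (@complexI R)).
Qed.

Lemma genC_dilop s v c : genC pi v c -> genC pi (dilop pi s v) (dilop pi s c).
Proof.
move=> vc; rewrite /genC (_ : (fun t => _) = (fun t : R =>
   dilop pi s ((t%:C)^-1 *: (dilop pi t v - v)))).
  exact: (rep_continuous hpi (axb_chart (0, s)) vc).
apply/funext => t; rewrite /dilop (repZ hpi) (repB hpi); congr (_ *: (_ - _)).
by rewrite -/(dilop pi t _) -!/(dilop pi s _) -!(dilopD hpi) addrC.
Qed.

Fixpoint core_n (n : nat) : set E := if n is m.+1 then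
    [set v | exists a c, [/\ genA pi v a, genC pi v c, core_n m a & core_n m c]]
  else setT.

(** The vectors to which the two generators can be applied any number of times
    in any order. *)
Definition core : set E := [set v | forall n, core_n n v].

Lemma core_genA v : core v -> exists2 a, genA pi v a & core a.
Proof.
move=> cv; have [a [_ [va _ _ _]]] := cv 1%N; exists a => // n.
have [a' [_ [va' _ na' _]]] := cv n.+1.
by rewrite (gen_unique va va').
Qed.

Lemma core_genC v : core v -> exists2 c, genC pi v c & core c.
Proof.
move=> cv; have [_ [c [_ vc _ _]]] := cv 1%N; exists c => // n.
have [_ [c' [_ vc' _ nc']]] := cv n.+1.
by rewrite (gen_unique vc vc').
Qed.

Lemma genA0 : genA pi 0 0.
Proof.
rewrite /genA (_ : (fun t => _) = cst 0); first exact: cvg_cst.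
by apply/funext => t; rewrite /transop (rep0 hpi) subrr scaler0.
Qed.

Lemma genC0 : genC pi 0 0.
Proof.
rewrite /genC (_ : (fun t => _) = cst 0); first exact: cvg_cst.
by apply/funext => t; rewrite /dilop (rep0 hpi) subrr scaler0.
Qed.

Lemma genA_ZD (x : R[i]) v w a a' : genA pi v a -> genA pi w a' ->
  genA pi (x *: v + w) (x *: a + a').
Proof. by apply: genZD => t; exact: transop_linear. Qed.

Lemma genC_ZD (x : R[i]) v w a a' : genC pi v a -> genC pi w a' ->
  genC pi (x *: v + w) (x *: a + a').
Proof. by apply: genZD => t; exact: dilop_linear. Qed.

Lemma core_subspace : is_subspace core.
Proof.
split=> [n|x v w cv cw n].
  elim: n => //= n IH; exists 0, 0; split=> //; [exact: genA0|exact: genC0].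
have {cv cw} := conj (cv n) (cw n).
elim: n v w => //= n IH v w [[a [c [va vc na nc]]] [a' [c' [wa wc na' nc']]]].
exists (x *: a + a'), (x *: c + c'); split.
- exact: genA_ZD.
- exact: genC_ZD.
- exact: IH.
- exact: IH.
Qed.

Lemma core_nZ n (x : R[i]) v : core_n n v -> core_n n (x *: v).
Proof.
elim: n v => //= n IH v [a [c [va vc na nc]]].
exists (x *: a), (x *: c); split; try exact: IH.
  by have := @genA_ZD x _ _ _ _ va genA0; rewrite !addr0.
by have := @genC_ZD x _ _ _ _ vc genC0; rewrite !addr0.
Qed.

Lemma core_dilop s v : core v -> core (dilop pi s v).
Proof.
move=> cv n; have {cv} := cv n.
elim: n v => //= n IH v [a [c [va vc na nc]]].
exists ((expR (- s))%:C *: dilop pi s a), (dilop pi s c); split.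
- exact: genA_dilop.
- exact: genC_dilop.
- by apply: core_nZ; exact: IH.
- exact: IH.
Qed.

End Cores.

Arguments genA_dilop {R E pi} hpi s {v a}.
Arguments genC_dilop {R E pi} hpi s {v c}.
Arguments genA_ZD {R E pi} hpi x {v w a a'}.
Arguments genC_ZD {R E pi} hpi x {v w a a'}.

(** * Smooth vectors *)

Section SmoothOrbits.
Context {R : realType} {E : hilbert R} (pi : axb R -> E -> E).
Context (hpi : unitary_rep pi).
Implicit Types u v w a c : E.

Lemma expR_quot (k : R) :
  h^-1 * (expR (k * h) - 1) @[h --> (0 : R)^'] --> k.
Proof.
have d : is_derive (0 : R) 1 (fun h => expR (k * h)) k.
  by apply: is_derive_eq; rewrite mulr0 expR0 mul1r /GRing.scale/= mulr1.
have := @ex_derive _ _ _ _ _ _ _ d; rewrite /derivable => dc.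
have dv := @derive_val _ _ _ _ _ _ _ d; rewrite /derive in dv.
move: (dc); rewrite /cvg_to dv => {dc dv d} dl; apply: cvg_trans dl.
apply: near_eq_cvg; apply: nearW => h /=.
by rewrite addr0 mulr0 expR0 /GRing.scale/= mulr1.
Qed.

(** The orbit map has the derivative e^-s pi(t, e^s) A v along the first
    coordinate; the exponential factor raises the weight by one. *)
Lemma genA_quot_at (k t s : R) v a : genA pi v a ->
  diffquot (fun p : R * R => (expR (- k * p.2))%:C *: pi (axb_chart p) v)
     (t, s) (1, 0) h @[h --> (0 : R)^'] -->
  (expR (- (k + 1) * s))%:C *: pi (axb_chart (t, s)) a.
Proof.
move=> va; rewrite (_ : _ *: _ = (expR (- k * s))%:C *: transop pi t
    ((expR (- s))%:C *: dilop pi s a)); last first.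
  rewrite (chartE hpi)/= /transop (repZ hpi) scalerA; congr (_ *: _).
  by rewrite -rmorphM/= -expRD; congr (expR _)%:C; lra.
have va' := genA_dilop hpi s va.
rewrite (_ : (fun h => _) = (fun h : R => (expR (- k * s))%:C *: transop pi t
    ((h%:C)^-1 *: (transop pi h (dilop pi s v) - dilop pi s v)))).
  by apply: cvgZl_tmp; exact: (rep_continuous hpi (axb_chart (t, 0)) va').
apply/funext => h; rewrite /diffquot /= !(chartE hpi)/= mulr1 mulr0 addr0.
rewrite (transopD hpi) -scalerBr scalerA [_ * (expR _)%:C]mulrC -scalerA.
by rewrite /transop (repZ hpi) (repB hpi).
Qed.

Lemma genC_quot_at (k t s : R) v c : genC pi v c ->
  diffquot (fun p : R * R => (expR (- k * p.2))%:C *: pi (axb_chart p) v)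
     (t, s) (0, 1) h @[h --> (0 : R)^'] -->
  (expR (- k * s))%:C *: pi (axb_chart (t, s)) (- k%:C *: v + c).
Proof.
move=> vc.
have quot : (h^-1 * (expR (- k * h) - 1))%:C *: v +
    (expR (- k * h))%:C *: ((h%:C)^-1 *: (dilop pi h v - v))
    @[h --> (0 : R)^'] --> (- k)%:C *: v + 1%:C *: c.
  apply: cvgD.
    by apply: cvgZ_real; [exact: expR_quot|exact: cvg_cst].
  apply: cvgZ_real vc.
  rewrite -[X in _ --> X](@expR0 R) -[in X in _ --> X](mulr0 (- k)).
  apply: (@cvg_comp _ _ _ (fun h => - k * h) expR); last exact: continuous_expR.
  by apply: cvgMr; exact: cvg_dnbhs0_id.
rewrite (_ : (fun h => _) = (fun h : R => (expR (- k * s))%:C *: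
    pi (axb_chart (t, s)) ((h^-1 * (expR (- k * h) - 1))%:C *: v +
    (expR (- k * h))%:C *: ((h%:C)^-1 *: (dilop pi h v - v))))).
  apply: cvgZl_tmp; apply: (rep_continuous hpi (axb_chart (t, s))).
  by move: quot; rewrite scale1r rmorphN.
apply/funext => h; rewrite /diffquot /= mulr0 mulr1 addr0.
rewrite (_ : - k * (s + h) = - k * s + - k * h); last by rewrite mulrDr.
rewrite expRD.
rewrite [pi (axb_chart (t, s + h)) v](_ : _ = pi (axb_chart (t, s)) (dilop pi h v)); last first.
  by rewrite !(chartE hpi)/= (dilopD hpi).
rewrite (repD hpi) !(repZ hpi) (repB hpi).
move: (pi _ v) (pi _ (dilop pi h v)) (expR (- k * h)) (expR (- k * s)) => x y f e.
rewrite !rmorphM rmorphB fmorphV/= rmorph1.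
move: (e%:C) (f%:C) ((h%:C)^-1) => {}e {}f i.
rewrite !scalerBr !scalerDr ?scalerBr ?scalerN !scalerA addrCA; congr (_ + _).
  by congr (_ *: _); ring.
rewrite -scalerBl -scaleNr; congr (_ *: _); ring.
Qed.

Lemma chart_weight_continuous (k : R) v :
  continuous (fun p : R * R => (expR (- k * p.2))%:C *: pi (axb_chart p) v).
Proof.
move=> p; apply: cvgZ_real; last by have [_ _ _ cont] := hpi; exact: cont.
apply: (@cvg_comp _ _ _ (fun p : R * R => - k * p.2) expR); last exact: continuous_expR.
by apply: cvgMr; exact: cvg_snd.
Qed.

(** The orbit maps of the vectors of S multiplied by the weights e^(-k s) form a
    class that is stable under both partial derivatives, which the orbit maps
    alone do not. *)
Lemma weighted_orbit_classC (S : set E) : is_subspace S ->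
  (forall v, S v -> exists2 a, genA pi v a & S a) ->
  (forall v, S v -> exists2 c, genC pi v c & S c) ->
  forall n (k : nat) v, S v ->
  class_C n (fun p : R * R => (expR (- k%:R * p.2))%:C *: pi (axb_chart p) v).
Proof.
move=> [S0 SD] SA SC; elim=> [|n IH] k v Sv; first by split=> //; exact: chart_weight_continuous.
split; first exact: chart_weight_continuous.
have [a va Sa] := SA v Sv; have [c vc Sc] := SC v Sv.
have qa t s := @genA_quot_at k%:R t s v a va.
have qc t s := @genC_quot_at k%:R t s v c vc.
split.
- by case=> t s; apply: cvgP; exact: qa.
- by case=> t s; apply: cvgP; exact: qc.
- rewrite (_ : pderiv _ _ =
    (fun p : R * R => (expR (- k.+1%:R * p.2))%:C *: pi (axb_chart p) a)).
    exact: IH.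
  by apply/funext => -[t s]; apply: cvg_lim; [exact: norm_hausdorff|rewrite -natr1; exact: qa].
rewrite (_ : pderiv _ _ =
  (fun p : R * R => (expR (- k%:R * p.2))%:C *: pi (axb_chart p) (- k%:R%:C *: v + c))).
  by apply: IH; exact: SD.
by apply/funext => -[t s]; apply: cvg_lim; [exact: norm_hausdorff|exact: qc].
Qed.

Lemma invariant_smooth (S : set E) : is_subspace S ->
  (forall v, S v -> exists2 a, genA pi v a & S a) ->
  (forall v, S v -> exists2 c, genC pi v c & S c) ->
  S `<=` smooth_vector pi.
Proof.
move=> S0 SA SC v Sv n; have := weighted_orbit_classC S0 SA SC n 0 Sv.
rewrite (_ : (fun p => _) = (fun p => pi (axb_chart p) v))//.
by apply/funext => p; rewrite oppr0 mul0r expR0 scale1r.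
Qed.

(** The chain rule at 0. *)
Lemma quot_comp (f : R -> E) (tau : R -> R) a (t : R) : f 0 = 0 ->
  (h%:C)^-1 *: f h @[h --> (0 : R)^'] --> a ->
  s^-1 * tau s @[s --> (0 : R)^'] --> t ->
  (s%:C)^-1 *: f (tau s) @[s --> (0 : R)^'] --> t%:C *: a.
Proof.
move=> f0 fa taut.
pose g h := if h == 0 then a else (h%:C)^-1 *: f h.
have fg h : f h = h%:C *: g h.
  rewrite /g; case: eqVneq => [->|h0]; first by rewrite f0 scale0r.
  by rewrite scalerA divff ?scale1r// -(rmorph0 (real_complex R)) (inj_eq (@complexI R)).
have ga : g h @[h --> (0 : R)] --> a.
  apply/cvg_rnormP => e e0; move/cvg_rnormP : fa => /(_ e e0).
  rewrite near_withinE; apply: filterS => h; rewrite /g; case: eqVneq => [_ _|_]; last exact.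
  by rewrite subrr rnorm0.
have tau0 : tau s @[s --> (0 : R)^'] --> (0 : R).
  rewrite -[X in _ --> X](mul0r t).
  apply: cvg_trans (cvgM cvg_dnbhs0_id taut); apply: near_eq_cvg; near=> s.
  have s0 : s != 0 by near: s; exact: near_dnbhs0_neq.
  by rewrite /= mulrA divff// mul1r.
have gtau : g (tau s) @[s --> (0 : R)^'] --> a.
  exact: (@cvg_comp _ _ _ tau g _ _ _ tau0 ga).
rewrite (_ : (fun s => _) = (fun s : R => (s^-1 * tau s)%:C *: g (tau s))).
  exact: cvgZ_real.
by apply/funext => s; rewrite fg scalerA rmorphM fmorphV.
Unshelve. all: by end_near. Qed.

Lemma axb_exp_transl (X : R * R) :
  s^-1 * transl (axb_exp (s * X.1, s * X.2)) @[s --> (0 : R)^'] --> X.1.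
Proof.
case: X => t x /=; have [->|x0] := eqVneq x 0.
  apply: cvg_near_cst; near=> s.
  have s0 : s != 0 by near: s; exact: near_dnbhs0_neq.
  by rewrite mulr0 eqxx mulrA mulVf// mul1r.
have xx : t = (t / x) * x by rewrite -mulrA mulVf// mulr1.
have q : (t / x) * (s^-1 * (expR (x * s) - 1)) @[s --> (0 : R)^'] --> (t / x) * x.
  by apply: cvgM; [exact: cvg_cst|exact: expR_quot].
rewrite [X in _ --> X]xx; apply: cvg_trans q; apply: near_eq_cvg; near=> s.
have s0 : s != 0 by near: s; exact: near_dnbhs0_neq.
by rewrite mulf_eq0 (negbTE s0) (negbTE x0)/= [x * s]mulrC; field; rewrite s0 x0.
Unshelve. all: by end_near. Qed.

(** The one-parameter subgroup is a product of a translation and a dilation, and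
    the translation factor tends strongly to the identity. *)
Lemma orbit_quot_cvg (X : R * R) v a c : genA pi v a -> genC pi v c ->
  orbit_quot pi X v s @[s --> (0 : R)^'] --> X.1%:C *: a + X.2%:C *: c.
Proof.
move=> va vc; pose tau s := transl (axb_exp (s * X.1, s * X.2)).
have qa : (s%:C)^-1 *: (transop pi (tau s) v - v) @[s --> (0 : R)^'] --> X.1%:C *: a.
  apply: (quot_comp (f := fun t => transop pi t v - v)) => //.
    by rewrite (transop0 hpi) subrr.
  exact: axb_exp_transl.
have qc : (s%:C)^-1 *: (dilop pi (s * X.2) v - v) @[s --> (0 : R)^'] --> X.2%:C *: c.
  apply: (quot_comp (f := fun t => dilop pi t v - v)) => //.
    by rewrite (dilop0 hpi) subrr.
  apply: cvg_near_cst; near=> s.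
  have s0 : s != 0 by near: s; exact: near_dnbhs0_neq.
  by rewrite mulrA mulVf// mul1r.
have tau00 : tau s @[s --> (0 : R)^'] --> (0 : R).
  rewrite -[X in _ --> X](mul0r X.1).
  apply: cvg_trans (cvgM cvg_dnbhs0_id (@axb_exp_transl X)); apply: near_eq_cvg; near=> s.
  have s0 : s != 0 by near: s; exact: near_dnbhs0_neq.
  exact: (mulVKf s0 (tau s)).
have tau0 : (tau s, 0) @[s --> (0 : R)^'] --> ((0, 0) : R * R).
  exact: (cvg_pair tau00 (@cvg_cst R (0:R) _ (0 : R)^' _)).
have qc' : transop pi (tau s) ((s%:C)^-1 *: (dilop pi (s * X.2) v - v))
    @[s --> (0 : R)^'] --> X.2%:C *: c.
  by rewrite -[X in _ --> X](transop0 hpi); exact: (rep_cvg hpi tau0 qc).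
rewrite (_ : (fun s => _) = (fun s : R => (s%:C)^-1 *: (transop pi (tau s) v - v)
   + transop pi (tau s) ((s%:C)^-1 *: (dilop pi (s * X.2) v - v)))).
  exact: cvgD.
apply/funext => s; rewrite /orbit_quot.
rewrite (_ : axb_exp _ = axb_chart (tau s, s * X.2)); last exact: axb_eq.
rewrite (chartE hpi)/= /transop (repZ hpi) (repB hpi) -scalerDr.
by congr (_ *: _); rewrite [RHS]addrC addrA subrK.
Unshelve. all: by end_near. Qed.

End SmoothOrbits.

(** * Nodes and weights whose moments are the powers of -i *)

Section Nodes.
Context {R : realType}.

Lemma ratio_cvg (u : R^nat) (N : nat) : (forall n, 0 <= u n) ->
  (forall n, (N <= n)%N -> 2 * u n.+1 <= u n) -> cvgn (series u).
Proof.
move=> u0 uN; apply: nondecreasing_is_cvgn.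
  by apply: nondecreasing_series => n _ _.
exists (series u N + 2 * u N) => _ [n _ <-].
have tail m : series u (N + m)%N + 2 * u (N + m)%N <= series u N + 2 * u N.
  elim: m => [|m IH]; first by rewrite addn0.
  apply: le_trans IH; rewrite addnS seriesSr -addrA lerD2l.
  by have := uN (N + m)%N (leq_addr _ _); lra.
have [nN|Nn] := leqP n N.
  rewrite (@le_trans _ _ (series u N))//.
    by apply: (nondecreasing_series (P := xpredT)) => // k _ _.
  by rewrite lerDl mulr_ge0.
have := tail (n - N)%N; rewrite subnKC ?(ltnW Nn)//; apply: le_trans.
by rewrite lerDl mulr_ge0.
Qed.

(** The coefficients of the entire function prod_(i >= 0) (1 - 2^-i z), by
    Euler's formula. It vanishes at all the points 2^k, so that the weights
    [ycoef n] at the points 2^n have all their moments equal to 0. *)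
Definition ycoef (n : nat) : R :=
  (- 2) ^+ n / \prod_(j < n) (2 ^+ j.+1 - 1).

Lemma pow2_gt1 n : 1 < 2 ^+ n.+1 :> R.
Proof. by rewrite exprn_egt1// ltr1n. Qed.

Lemma ycoef0 : ycoef 0 = 1.
Proof. by rewrite /ycoef big_ord0 expr0 divr1. Qed.

Lemma ycoefS n : ycoef n.+1 * (2 ^+ n.+1 - 1) = - 2 * ycoef n.
Proof.
rewrite /ycoef big_ord_recr/= exprS.
have h : 2 ^+ n.+1 - 1 != 0 :> R by rewrite subr_eq0 gt_eqF// pow2_gt1.
have p : \prod_(j < n) (2 ^+ j.+1 - 1) != 0 :> R.
  by apply/prodf_neq0 => j _; rewrite subr_eq0 gt_eqF// pow2_gt1.
by field; rewrite h p.
Qed.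

Lemma ycoef_neq0 n : ycoef n != 0.
Proof.
rewrite /ycoef mulf_neq0// ?expf_neq0 ?oppr_eq0 ?pnatr_eq0// invr_eq0.
by apply/prodf_neq0 => j _; rewrite subr_eq0 gt_eqF// pow2_gt1.
Qed.

Lemma abs_ycoefS n : `|ycoef n.+1| * (2 ^+ n.+1 - 1) = 2 * `|ycoef n|.
Proof.
rewrite -[X in _ * X = _]ger0_norm ?subr_ge0 ?ltW ?pow2_gt1//.
by rewrite -normrM ycoefS normrM normrN normr_nat.
Qed.

(** The affine map x |-> 3 x - 4 sends the point 1 to -1 and all the other powers
    of 2 to numbers greater than 1. *)
Definition moment (j k n : nat) : R := ycoef n * 2 ^+ n ^+ j * (3 * 2 ^+ n - 4) ^+ k.

(** The recursion of [ycoef] relates the moments of orders j and j + 1, so that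
    the vanishing of the first one propagates. *)
Lemma moment_rec j n :
  moment j.+1 0 n.+1 = moment j 0 n.+1 - 2 ^+ j.+1 * moment j 0 n.
Proof.
rewrite /moment !mulr1.
have -> : ycoef n.+1 * 2 ^+ n.+1 ^+ j.+1 = ycoef n.+1 * 2 ^+ n.+1 ^+ j
    + ycoef n.+1 * (2 ^+ n.+1 - 1) * 2 ^+ n.+1 ^+ j.
  by rewrite [2 ^+ n.+1 ^+ j.+1]exprS; ring.
by rewrite ycoefS [2 ^+ n.+1]exprS exprMn [2 ^+ j.+1]exprS; ring.
Qed.

Lemma cvg_ycoef : ycoef @ \oo --> (0 : R).
Proof.
apply/norm_cvg0P/cvg_series_cvg_0/(@ratio_cvg _ 3) => n; first exact: normr_ge0.
move=> n3; have := abs_ycoefS n.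
have : 8 <= 2 ^+ n.+1 :> R by rewrite (_ : 8 = 2 ^+ 3) ?ler_weXn2l ?ler1n// ?(leq_trans n3)//; ring.
have := normr_ge0 (ycoef n.+1); nra.
Qed.

Lemma moment0_series n : series (moment 0 0) n.+1 = ycoef n / 2 ^+ n.
Proof.
elim: n => [|n IH].
  by rewrite /series/= big_nat1 /moment ycoef0 !mulr1 expr0 divr1.
rewrite seriesSr IH /moment !mulr1.
have := ycoefS n; rewrite [2 ^+ n.+1]exprS => h.
have -> : ycoef n = ycoef n.+1 * (2 * 2 ^+ n - 1) / - 2.
  by rewrite h; field.
by field; rewrite expf_neq0.
Qed.

Lemma moments_vanish j k : series (moment j k) @ \oo --> (0 : R).
Proof.
elim: k j => [|k IH] j; last first.
  rewrite (_ : moment j k.+1 = (fun n => 3 * moment j.+1 k n - 4 * moment j k n)); last first.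
    by apply/funext => n; rewrite /moment !exprS; ring.
  rewrite (_ : series _ = (fun n => 3 * series (moment j.+1 k) n - 4 * series (moment j k) n)); last first.
    by apply/funext => n; rewrite /series/= sumrB !mulr_sumr.
  rewrite -[X in _ --> X](subr0 0) -{1}(mulr0 3) -[in X in _ - X](mulr0 4).
  by apply: cvgB; apply: cvgMr; exact: IH.
elim: j => [|j IH]; rewrite -cvg_shiftS/=.
  rewrite (_ : (fun n => _) = (fun n => ycoef n * (2 ^- n))); last first.
    by apply/funext => n; rewrite moment0_series.
  apply/norm_cvg0P; apply: (squeeze_cvgr _ (cvg_cst 0) ((norm_cvg0P _).2 cvg_ycoef)).
  apply: nearW => n; rewrite normr_ge0/= normrM ler_piMr//.
  by rewrite ger0_norm ?invr_ge0 ?exprn_ge0// invf_le1 ?exprn_gt0// exprn_ege1// ler1n.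
rewrite (_ : (fun n => _) = (fun n => series (moment j 0) n.+1
    - 2 ^+ j.+1 * series (moment j 0) n)); last first.
  apply/funext; elim=> [|n IHn].
    by rewrite /series/= !big_nat1 big_geq// mulr0 subr0 /moment expr0 !expr1n.
  rewrite seriesSr IHn moment_rec [in RHS]seriesSr [series _ n.+1 in X in _ = _ - X]seriesSr.
  by ring.
have IH1 : series (moment j 0) n.+1 @[n --> \oo] --> (0 : R) by rewrite cvg_shiftS.
have IH2 : 2 ^+ j.+1 * series (moment j 0) n @[n --> \oo] --> 2 ^+ j.+1 * (0 : R).
  by apply: cvgMr.
have : series (moment j 0) n.+1 - 2 ^+ j.+1 * series (moment j 0) n @[n --> \oo]
    --> (0 - 2 ^+ j.+1 * 0 : R) by apply: cvgB.
by rewrite mulr0 subr0.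
Qed.

Definition radius2 (n : nat) : R := 3 * 2 ^+ n.+1 - 4.
Definition xcoef (n : nat) : R := - ycoef n.+1.

(** As all the moments of the full family vanish, the points other than -1, with
    the opposite weights, have the moments of the unit mass at -1. *)
Lemma xcoef_moment k :
  series (fun n => xcoef n * radius2 n ^+ k) @ \oo --> (- 1 : R) ^+ k.
Proof.
have m := moments_vanish 0 k; rewrite -cvg_shiftS/= in m.
rewrite (_ : series _ = (fun n => (-1) ^+ k - series (moment 0 k) n.+1)); last first.
  apply/funext; elim=> [|n IH].
    rewrite /series/= big_geq// big_nat1 /moment ycoef0 expr0 !mul1r mulr1.
    by rewrite (_ : 3 - 4 = -1) ?subrr//; lra.
  rewrite seriesSr IH [series (moment 0 k) n.+2]seriesSr /moment /xcoef /radius2 expr0 mulr1.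
  by ring.
have : (-1) ^+ k - series (moment 0 k) n.+1 @[n --> \oo] --> ((-1) ^+ k - 0 : R).
  by apply: cvgB => //; exact: cvg_cst.
by rewrite subr0.
Qed.

Lemma pow2S_ge2 n : 2 <= 2 ^+ n.+1 :> R.
Proof. by rewrite exprS ler_peMr// exprn_ege1// ler1n. Qed.

Lemma radius2_ge1 n : 1 <= radius2 n.
Proof. by have := pow2S_ge2 n; rewrite /radius2; lra. Qed.

Lemma radius2S n : radius2 n.+1 <= 4 * radius2 n.
Proof. by have := pow2S_ge2 n; rewrite /radius2 [2 ^+ n.+2]exprS; lra. Qed.

Lemma xcoef_summable k : cvgn (series (fun n => `|xcoef n| * radius2 n ^+ k)).
Proof.
apply: (@ratio_cvg _ (2 * k).+1) => n.
  by rewrite mulr_ge0// exprn_ge0// (le_trans ler01 (radius2_ge1 n)).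
move=> kn; rewrite /xcoef !normrN.
have r0 m : 0 <= radius2 m by exact: le_trans ler01 (radius2_ge1 m).
have a : radius2 n.+1 ^+ k <= 4 ^+ k * radius2 n ^+ k.
  by rewrite -exprMn lerXn2r ?nnegrE ?mulr_ge0// radius2S.
have b : 2 * (4 ^+ k * `|ycoef n.+2|) <= `|ycoef n.+1|.
  have := abs_ycoefS n.+1.
  have p : 8 * 4 ^+ k <= 2 ^+ n.+2 :> R.
    rewrite (_ : 8 = 2 ^+ 3); last by ring.
    rewrite (_ : 4 = 2 ^+ 2); last by ring.
    by rewrite -exprM -exprD ler_weXn2l// ?ler1n// add3n !ltnS.
  have q : 1 <= 4 ^+ k :> R by rewrite exprn_ege1// ler1n.
  have y0 := normr_ge0 (ycoef n.+2).
  have : `|ycoef n.+2| * (4 * 4 ^+ k) <= `|ycoef n.+2| * (2 ^+ n.+2 - 1).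
    by apply: ler_wpM2l => //; lra.
  lra.
rewrite (@le_trans _ _ (2 * (`|ycoef n.+2| * (4 ^+ k * radius2 n ^+ k))))//.
  by rewrite ler_wpM2l// ler_wpM2l.
rewrite (_ : 2 * _ = 2 * (4 ^+ k * `|ycoef n.+2|) * radius2 n ^+ k); last by ring.
by rewrite ler_wpM2r// exprn_ge0.
Qed.

Definition node (i : nat * bool) : R :=
  if i.2 then Num.sqrt (radius2 i.1) else - Num.sqrt (radius2 i.1).

Lemma node_flip i : node (flip i) = - node i.
Proof. by case: i => n [] /=; rewrite /node/= ?opprK. Qed.

Lemma node_sq i : node i ^+ 2 = radius2 i.1.
Proof.
have r0 : 0 <= radius2 i.1 by exact: le_trans ler01 (radius2_ge1 _).
by rewrite /node; case: ifP => _; rewrite ?sqrrN sqr_sqrtr.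
Qed.

Lemma node_neq0 i : node i != 0.
Proof. by rewrite -sqrf_eq0 node_sq gt_eqF// (lt_le_trans ltr01 (radius2_ge1 _)). Qed.

(** At the nodes s and -s with s^2 = r the weights are x (1 - i / s) / 2 and
    x (1 + i / s) / 2: the even moments only see x r^m, the odd ones -i x r^m. *)
Definition weight (i : nat * bool) : R[i] :=
  (xcoef i.1 / 2) +i* (- (xcoef i.1 / 2 / node i)).

Lemma weight_flip i : weight (flip i) = (weight i)^*%C.
Proof. by rewrite /weight /= node_flip invrN mulrN opprK. Qed.

Lemma weight_neq0 i : weight i != 0.
Proof.
rewrite eq_complex/= negb_and mulf_neq0//.
by rewrite /xcoef oppr_eq0 ycoef_neq0.
Qed.

Lemma weight_moment k :
  ctotal (fun i => weight i * (node i ^+ k)%:C) = (- 'i%C) ^+ k.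
Proof.
rewrite /ctotal /total.
have im m : (- 'i%C) ^+ m.*2 = (-1) ^+ m +i* 0 :> R[i].
  by rewrite complexr0 -muln2 mulnC exprM sqrrN sqr_i rmorphXn/= rmorphN1.
have [m [->|->]] : exists m, k = m.*2 \/ k = m.*2.+1.
  by exists k./2; case: (boolP (odd k)) => ok; [right|left];
    rewrite -[LHS]odd_double_half ?ok ?(negbTE ok).
- have e i : node i ^+ m.*2 = radius2 i.1 ^+ m by rewrite -muln2 mulnC exprM node_sq.
  rewrite im (_ : pairsum _ = (fun n => xcoef n * radius2 n ^+ m)); last first.
    by apply/funext => n; rewrite /pairsum !e /weight; simpc => /=; field.
  congr (_ +i* _); first by apply: cvg_lim => //; exact: xcoef_moment.
  rewrite (_ : series _ = cst 0) ?lim_cst//; last first.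
    apply/funext => n; rewrite /series/= big1// => j _.
    rewrite /pairsum !e /weight; simpc => /=.
    by rewrite (node_flip (j, true)); field; rewrite node_neq0.
have e i : node i ^+ m.*2.+1 = node i * radius2 i.1 ^+ m.
  by rewrite exprS -muln2 mulnC exprM node_sq.
rewrite exprS im (_ : series (pairsum (fun i => complex.Re _)) = cst 0) ?lim_cst//; last first.
  apply/funext => n; rewrite /series/= big1// => j _.
  rewrite /pairsum !e /weight; simpc => /=.
  by rewrite /node/=; ring.
rewrite (_ : pairsum (fun i => complex.Im _) = (fun n => - (xcoef n * radius2 n ^+ m))); last first.
  have h i : complex.Im (weight i * (node i ^+ m.*2.+1)%:C) =
      - (xcoef i.1 / 2 * radius2 i.1 ^+ m).
    rewrite e /weight; move: (node_neq0 i).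
    by move: (node i) (xcoef i.1) (radius2 _ ^+ m) => s x r s0; simpc => /=; field.
  by apply/funext => n; rewrite /pairsum !h; field.
rewrite (_ : series _ = (fun n => - series (fun n => xcoef n * radius2 n ^+ m) n)); last first.
  by apply/funext => n; rewrite /series/= sumrN.
have -> : limn (fun n => - series (fun n => xcoef n * radius2 n ^+ m) n) = - (-1) ^+ m.
  by apply: cvg_lim => //; apply: cvgN; exact: xcoef_moment.
by apply/eqP; rewrite eq_complex/=; apply/andP; split; apply/eqP; ring.
Qed.

Lemma weight_norm_le i : complex.Re `|weight i| <= `|xcoef i.1|.
Proof.
rewrite normc_def /=.
have x2 : `|xcoef i.1| = Num.sqrt (xcoef i.1 ^+ 2) by rewrite sqrtr_sqr.
rewrite x2 ler_wsqrtr// sqrrN !expr_div_n node_sq.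
have := radius2_ge1 i.1; move: (radius2 i.1) => r r1.
have : r^-1 <= 1 by rewrite invf_le1// (lt_le_trans ltr01 r1).
have := sqr_ge0 (xcoef i.1); move: (xcoef i.1 ^+ 2) (r^-1) => x s x0 s1.
have : x * s <= x by rewrite ler_piMr.
by rewrite -mulrA; lra.
Qed.

(** In the factorization weight = phase * amp^2, the amplitudes define vectors
    of the Hilbert sum, the phases define the reflection. *)
Definition amp (i : nat * bool) : R := Num.sqrt (complex.Re `|weight i|).
Definition phase (i : nat * bool) : R[i] := weight i / `|weight i|.

Lemma amp_ge0 i : 0 <= amp i. Proof. exact: sqrtr_ge0. Qed.

Lemma amp_flip i : amp (flip i) = amp i.
Proof. by rewrite /amp weight_flip normcJ. Qed.

Lemma amp_sqE i : amp i ^+ 2 = complex.Re `|weight i|.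
Proof.
by rewrite sqr_sqrtr// -ler0c (RRe_real (normr_real _)) normr_ge0.
Qed.

Lemma amp_sq i : (amp i ^+ 2)%:C = `|weight i|.
Proof. by rewrite amp_sqE (RRe_real (normr_real _)). Qed.

Lemma phase_amp i : phase i * (amp i ^+ 2)%:C = weight i.
Proof. by rewrite amp_sq divfK// normr_eq0 weight_neq0. Qed.

Lemma phase_conj i : phase i * (phase i)^*%C = 1.
Proof.
rewrite -sqr_normc /phase normrM normfV normr_id divff ?expr1n//.
by rewrite normr_eq0 weight_neq0.
Qed.

Lemma phase_flip i : phase (flip i) = (phase i)^*%C.
Proof.
rewrite /phase weight_flip normcJ rmorphM fmorphV; congr (_ / _).
by rewrite -amp_sq /= oppr0.
Qed.

Lemma phase_mul_flip i : phase i * phase (flip i) = 1.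
Proof. by rewrite phase_flip phase_conj. Qed.

Lemma phase_norm i : `|phase i| = 1.
Proof.
rewrite /phase normrM normfV normr_id divff//.
by rewrite normr_eq0 weight_neq0.
Qed.

Lemma amp_node_summable k : summable (fun i => (amp i * node i ^+ k) ^+ 2).
Proof.
have s := @xcoef_summable k.
have s2 : cvgn (series (fun n => 2 * (`|xcoef n| * radius2 n ^+ k))).
  exact: is_cvg_seriesZ.
apply: series_le_cvg s2 => n.
- by apply: pairsum_ge0 => i; exact: sqr_ge0.
- have r0 : 0 <= radius2 n by exact: le_trans ler01 (radius2_ge1 n).
  by rewrite mulr_ge0// mulr_ge0// exprn_ge0.
have le b : (amp (n, b) * node (n, b) ^+ k) ^+ 2 <= `|xcoef n| * radius2 n ^+ k.
  have r0 : 0 <= radius2 n by exact: le_trans ler01 (radius2_ge1 n).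
  rewrite exprMn amp_sqE -exprM mulnC exprM node_sq/=.
  by rewrite ler_wpM2r ?exprn_ge0// (weight_norm_le (n, b)).
by have := le true; have := le false; rewrite /pairsum; lra.
Qed.

Lemma weight_csummable k : csummable (fun i => weight i * (node i ^+ k)%:C).
Proof.
have s := summableD (@amp_node_summable 0) (@amp_node_summable k).
apply: csummable_abs s => i.
rewrite normrM normc_real -amp_sq -rmorphM/= expr0 mulr1 exprMn -{2}[amp i ^+ 2]mulr1 -mulrDr.
rewrite ler_wpM2l ?sqr_ge0// -(real_normK (num_real (node i ^+ k))).
move: `|node i ^+ k| => x; have := sqr_ge0 (x - 1); have := sqr_ge0 x.
by rewrite !expr2; lra.
Qed.

End Nodes.

Arguments amp_node_summable {R} k.

(** * Smooth functions supported in the interval from 1 to 2 *)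

Section TestFunctions.
Context {R : realType}.
Implicit Types f g : R -> R.

Fixpoint diff_n (n : nat) f : Prop := if n is m.+1 then
    exists2 f', (forall x : R, is_derive x 1 f (f' x)) & diff_n m f'
  else continuous f.

Lemma diff_n_continuous n f : diff_n n f -> continuous f.
Proof.
case: n => //= n [f' ff' _] x; apply/differentiable_continuous/derivable1_diffP.
by have := ff' x; case.
Qed.

Lemma diff_nS n f : diff_n n.+1 f -> diff_n n f.
Proof.
elim: n f => [f|n IH f [f' ff' nf']]; first exact: diff_n_continuous.
by exists f' => //; exact: IH.
Qed.

Lemma diff_n_cst n (c : R) : diff_n n (cst c).
Proof.
elim: n c => [c|n IH c]; first exact: cst_continuous.
by exists (cst 0); [move=> x; exact: is_derive_cst|exact: IH].
Qed.

Lemma diff_nD n f g : diff_n n f -> diff_n n g -> diff_n n (fun x => f x + g x).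
Proof.
elim: n f g => [f g cf cg x|n IH f g [f' ff' nf] [g' gg' ng]].
  by apply: cvgD; [exact: cf|exact: cg].
exists (fun x => f' x + g' x); last exact: IH.
by move=> x; have := ff' x; have := gg' x => *; exact: is_deriveD.
Qed.

Lemma diff_nM n f g : diff_n n f -> diff_n n g -> diff_n n (fun x => f x * g x).
Proof.
elim: n f g => [f g cf cg x|n IH f g nf ng].
  by apply: cvgM; [exact: cf|exact: cg].
have [[f' ff' nf'] [g' gg' ng']] := (nf, ng).
exists (fun x => f x * g' x + g x * f' x).
  by move=> x; have := ff' x; have := gg' x => *; exact: is_deriveM.
by apply: diff_nD; apply: IH => //; exact: diff_nS.
Qed.

Lemma diff_n_affine n f (a b : R) : diff_n n f -> diff_n n (fun x => f (a + b * x)).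
Proof.
elim: n f => [f cf x|n IH f [f' ff' nf]].
  apply: (@cvg_comp _ _ _ (fun x => a + b * x) f); last exact: cf.
  by apply: cvgD; [exact: cvg_cst|apply: cvgMr; exact: cvg_id].
exists (fun x => b * f' (a + b * x)).
  move=> x; have d : is_derive x 1 (fun x => a + b * x) b.
    by apply: is_derive_eq; rewrite add0r mul1r /GRing.scale/= mulr1.
  have := ff' (a + b * x) => ?.
  by apply: is_derive_eq; rewrite mulrC.
by apply: diff_nM; [exact: diff_n_cst|exact: IH].
Qed.

Lemma diff_n_expR n (k : R) : diff_n n (fun x => expR (k * x)).
Proof.
suff h c : diff_n n (fun x => c * expR (k * x)).
  by have := h 1; under eq_fun do rewrite mul1r.
elim: n c => [c x|n IH c].
  apply: cvgMr; apply: (@cvg_comp _ _ _ (fun x => k * x) expR); last exact: continuous_expR.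
  by apply: cvgMr; exact: cvg_id.
exists (fun x => (c * k) * expR (k * x)); last exact: IH.
by move=> x; apply: is_derive_eq; rewrite /GRing.scale/= mulr1; ring.
Qed.

(** The powers of 1 / x make the family stable under differentiation. *)
Definition flat (m : nat) (x : R) : R :=
  if 0 < x then x^-1 ^+ m * expR (- x^-1) else 0.

Lemma flat_ge0 m x : 0 <= flat m x.
Proof.
by rewrite /flat; case: ifP => // x0; rewrite mulr_ge0 ?expR_ge0// exprn_ge0// invr_ge0 ltW.
Qed.

(** From the term of degree m + 1 of the series of exp(1 / x). *)
Lemma flat_le m x : 0 < x -> flat m x <= m.+1`!%:R * x.
Proof.
move=> x0; rewrite /flat x0 expRN -ler_pdivlMr; last by rewrite invr_gt0 expR_gt0.
rewrite invrK; have xi0 : 0 <= x^-1 by rewrite invr_ge0 ltW.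
have := expR_ge1Dxn m xi0; rewrite exprS.
have f0 : 0 < m.+1`!%:R :> R by rewrite ltr0n fact_gt0.
move=> h; have : x^-1 * x^-1 ^+ m / m.+1`!%:R <= expR x^-1 by lra.
rewrite ler_pdivrMr// => {}h.
have := ler_wpM2l (ltW x0) h; rewrite mulrA mulfV ?gt_eqF// mul1r.
by move/le_trans; apply; rewrite le_eqVlt; apply/orP; left; apply/eqP; ring.
Qed.

Lemma flat_derive m (x : R) :
  is_derive x 1 (flat m) (- m%:R * flat m.+1 x + flat m.+2 x).
Proof.
have [x0|x0|<-] := ltgtP 0 x.
- have xn0 : x != 0 by rewrite gt_eqF.
  have dV : is_derive x 1 (fun y : R => y^-1) (- x ^- 2).
    have := @is_deriveV R id x 1 1 xn0 _.
    by rewrite /GRing.scale/= mulr1; apply.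
  apply: (@near_eq_is_derive _ _ _ (fun y : R => y^-1 ^+ m * expR (- y^-1))) => //.
    by near=> y; rewrite /flat ifT//; near: y; exact: lt_nbhsr.
  have dX : is_derive x 1 (fun y : R => y^-1 ^+ m) (- m%:R * x^-1 ^+ m.+1).
    clear -dV xn0; elim: m => [|m IH].
      rewrite oppr0 mul0r (_ : (fun y : R => _) = cst 1); first exact: is_derive_cst.
      by apply/funext => y; rewrite expr0.
    rewrite (_ : (fun y : R => _) = (fun y => y^-1) \* (fun y => y^-1 ^+ m)); last first.
      by apply/funext => y; rewrite /= exprS.
    by apply: is_derive_eq; rewrite /GRing.scale/= -natr1 !exprS; field.
  have dE : is_derive x 1 (fun y : R => expR (- y^-1)) (expR (- x^-1) * x ^- 2).
    have dN : is_derive x 1 (fun y : R => - y^-1) (x ^- 2).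
      by rewrite -[X in is_derive _ _ _ X]opprK; exact: is_deriveN.
    exact: (@is_derive1_comp _ expR (fun y => - y^-1)).
  apply: (is_derive_eq (is_deriveM dX dE)).
  rewrite /flat x0 /GRing.scale/= !exprS; by field.
- have -> : - m%:R * flat m.+1 x + flat m.+2 x = 0.
    by rewrite /flat lt_gtF// mulr0 addr0.
  apply: (@near_eq_is_derive _ _ _ (cst 0)) => //.
    near=> y; rewrite /flat ifF//; apply/negbTE; rewrite -leNgt ltW//; near: y.
    exact: lt_nbhsl.
have -> : - m%:R * flat m.+1 0 + flat m.+2 0 = 0.
  by rewrite /flat ltxx mulr0 addr0.
have q : h^-1 *: (flat m (h *: 1 + 0) - flat m 0) @[h --> (0 : R)^'] --> (0 : R).
  apply/cvgrPdist_le => e e0; near=> h.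
  have h0 : h != 0 by near: h; exact: nbhs_dnbhs_neq.
  rewrite sub0r normrN addr0 /flat ltxx subr0 /GRing.scale/= mulr1 -/(flat m h).
  have [hlt|hgt|heq] := ltgtP 0 h; last by rewrite -heq eqxx in h0.
    rewrite (_ : h^-1 * flat m h = flat m.+1 h); last first.
      by rewrite /flat hlt exprS mulrA.
    rewrite ger0_norm ?flat_ge0//; apply: le_trans (flat_le m.+1 hlt) _.
    have f0 : 0 < m.+2`!%:R :> R by rewrite ltr0n fact_gt0.
    rewrite -ler_pdivlMl// (le_trans (ler_norm h))//; near: h.
    by apply: dnbhs0_le; rewrite mulr_gt0// invr_gt0.
  by rewrite /flat lt_gtF// mulr0 normr0 ltW.
apply: DeriveDef.
  by apply: cvgP; exact: q.
by rewrite /derive; apply: cvg_lim => //; exact: q.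
Unshelve. all: by end_near. Qed.

Lemma diff_n_flat n m : diff_n n (flat m).
Proof.
elim: n m => [m|n IH m] /=.
  move=> x; apply/differentiable_continuous/derivable1_diffP.
  by have := flat_derive m x; case.
exists (fun x => - m%:R * flat m.+1 x + flat m.+2 x); first exact: flat_derive.
by apply: diff_nD => //; apply: diff_nM => //; exact: diff_n_cst.
Qed.

Definition test f : Prop :=
  (forall n, diff_n n f) /\ (forall x, x < 1 \/ 2 < x -> f x = 0).

Lemma test_continuous f : test f -> continuous f.
Proof. by case=> /(_ 0). Qed.

Lemma testM f g : test f -> (forall n, diff_n n g) -> test (fun x => f x * g x).
Proof.
move=> [nf f0] ng; split=> [n|x /f0 ->]; last by rewrite mul0r.
exact: diff_nM.
Qed.

Lemma test_derive f : test f ->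
  exists2 f', (forall x : R, is_derive x 1 f (f' x)) & test f'.
Proof.
move=> [nf f0]; have [f' ff' _] := nf 1; exists f' => //; split=> [n|x x12].
  have [f'' ff'' nf''] := nf n.+1.
  suff -> : f' = f'' by [].
  apply/funext => x; have [_ <-] := ff' x; by have [_ <-] := ff'' x.
have [_ <-] := ff' x.
rewrite (@near_eq_derive _ _ _ f (cst 0))//; first exact: derive_cst.
case: x12 => x12.
  by near=> y; apply: f0; left; near: y; exact: lt_nbhsl.
by near=> y; apply: f0; right; near: y; exact: lt_nbhsr.
Unshelve. all: by end_near. Qed.

Lemma flat0_ge (x : R) : 4^-1 <= x -> expR (- 4) <= flat 0 x.
Proof.
move=> x4; have x0 : 0 < x by apply: lt_le_trans x4; rewrite invr_gt0.
rewrite /flat x0 expr0 mul1r ler_expR lerN2.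
by rewrite -[leRHS]invrK lef_pV2 ?posrE// invr_gt0.
Qed.

Lemma test_bump : exists f, [/\ test f, forall x, 0 <= f x &
  exists2 c, 0 < c & forall x, 5 / 4 <= x <= 7 / 4 -> c <= f x].
Proof.
exists (fun x => flat 0 (- 1 + 1 * x) * flat 0 (2 + (-1) * x)); split.
- split=> [n|x x12].
    by apply: diff_nM; apply: diff_n_affine; exact: diff_n_flat.
  case: x12 => x12.
    by rewrite /flat ifF ?mul0r//; apply/negbTE; rewrite -leNgt; lra.
  by rewrite mulrC /flat ifF ?mul0r//; apply/negbTE; rewrite -leNgt; lra.
- by move=> x; rewrite mulr_ge0// flat_ge0.
exists (expR (- 4) * expR (- 4)); first by rewrite mulr_gt0 ?expR_gt0.
move=> x /andP[x1 x2]; apply: ler_pM; rewrite ?expR_ge0//; apply: flat0_ge; lra.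
Qed.

End TestFunctions.

(** * Integrals of continuous vector-valued functions of compact support *)

Section UniformContinuity.
Context {R : realType} {V : normedModType R[i]}.
Implicit Types F G : R -> V.

Definition supported (a b : R) F : Prop := forall x, x < a \/ b < x -> F x = 0.

Lemma supported_unif (a b : R) F : continuous F -> supported a b F ->
  forall e, 0 < e -> exists2 d, 0 < d &
    forall x y, `|x - y| < d -> rnorm (F x - F y) < e.
Proof.
move=> cF sF e e0.
have K : compact `[a - 1, b + 1] by exact: segment_compact.
have := (compact_near_coveringP `[a - 1, b + 1]).1 K R (0 : R)^'+
  (fun d x => forall y, `|x - y| < d -> rnorm (F x - F y) < e) _.
case.
  move=> x _; have /cvg_rnormP/(_ (e / 2)) := cF x.
  rewrite divr_gt0// => /(_ isT)/nbhs_ballP[r /= r0 rF].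
  have r2 : 0 < r / 2 by rewrite divr_gt0.
  near=> x' d => y x'y.
  have xx' : `|x - x'| < r / 2.
    by near: x'; exact: (@nbhsx_ballx _ _ x _ r2).
  have dr : d < r / 2 by near: d; exact: nbhs_right_lt.
  have e1 : rnorm (F x' - F x) < e / 2.
    by apply: rF; rewrite /ball/= (lt_trans xx')//; lra.
  have e2 : rnorm (F y - F x) < e / 2.
    apply: rF; rewrite /ball/= (le_lt_trans (ler_distD x' _ _))//.
    by rewrite (splitr r) ltrD// (lt_trans x'y).
  by apply: le_lt_trans (rnormBB _ _ (F x)) _; rewrite (rnormB (F x)); lra.
move=> r /= r0 rF.
exists (Num.min (r / 2) 1); first by rewrite lt_min divr_gt0//=.
move=> x y; rewrite lt_min => /andP[xyr xy1].
have [xab|] := boolP (x \in `[a - 1, b + 1]).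
  apply: (rF (r / 2)) xyr => //=; last by rewrite divr_gt0.
  by rewrite sub0r normrN ger0_norm; lra.
rewrite in_itv/= negb_and -!ltNge => /orP xab.
move: xy1; rewrite ltr_norml => /andP[y1 y2].
rewrite !sF ?subrr ?rnorm0//.
  by case: xab => ?; [left|right]; lra.
by case: xab => ?; [left|right]; lra.
Unshelve. all: by end_near. Qed.

End UniformContinuity.

Section RiemannSums.
Context {R : realType} {V : completeNormedModType R[i]}.
Implicit Types F G : R -> V.

Definition mesh (n : nat) : R := 2 ^- n.

(** The interval from 0 to 4 contains the supports of the translates, by at most
    1, of the functions supported between 1 and 2. *)
Definition rsum (n : nat) F : V :=
  (mesh n)%:C *: \sum_(0 <= j < 4 * 2 ^ n) F (j%:R * mesh n).

Lemma mesh_gt0 n : 0 < mesh n.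
Proof. by rewrite invr_gt0 exprn_gt0. Qed.

Lemma mesh_ge0 n : 0 <= mesh n.
Proof. exact: ltW (mesh_gt0 n). Qed.

Lemma mesh_cvg : mesh n @[n --> \oo] --> (0 : R).
Proof.
rewrite /mesh; under eq_cvg do rewrite -exprVn; apply: cvg_expr.
by rewrite ger0_norm ?invr_ge0// invf_lt1// ltr1n.
Qed.

Lemma mesh_pow n : mesh n * (2 ^ n)%:R = 1.
Proof. by rewrite /mesh natrX mulVf// expf_neq0. Qed.

Lemma sum_rnorm_le (N : nat) (f : nat -> V) (M : R) :
  (forall j, (j < N)%N -> rnorm (f j) <= M) ->
  rnorm (\sum_(0 <= j < N) f j) <= M * N%:R.
Proof.
move=> fM; apply: le_trans (rnorm_sum _ _ _) _.
have -> : M * N%:R = \sum_(0 <= j < N) M by rewrite sumr_const_nat subn0 mulr_natr.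
rewrite big_nat_cond [leRHS]big_nat_cond.
by apply: ler_sum => j /andP[/andP[_ jN] _]; exact: fM.
Qed.

Lemma rsum_le n F (M : R) : (forall x, rnorm (F x) <= M) ->
  rnorm (rsum n F) <= 4 * M.
Proof.
move=> FM; rewrite /rsum rnormZr ger0_norm ?mesh_ge0//.
apply: (@le_trans _ _ (mesh n * (M * (4 * 2 ^ n)%:R))).
  by rewrite ler_wpM2l ?mesh_ge0//; apply: sum_rnorm_le => j _; exact: FM.
rewrite natrM (_ : mesh n * _ = (mesh n * (2 ^ n)%:R) * (4 * M)); last by ring.
by rewrite mesh_pow mul1r.
Qed.

Lemma rsumB n F G : rsum n (fun x => F x - G x) = rsum n F - rsum n G.
Proof. by rewrite /rsum sumrB scalerBr. Qed.

(** A refinement of the subdivision moves the points of evaluation by less than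
    one step. *)
Lemma rsum_refine n p F (d e : R) : mesh n < d -> 
  (forall x y, `|x - y| < d -> rnorm (F x - F y) < e) ->
  rnorm (rsum (n + p) F - rsum n F) <= 4 * e.
Proof.
move=> nd Fd; rewrite /rsum expnD mulnA big_nat_mul.
have -> : (mesh n)%:C *: \sum_(0 <= j < 4 * 2 ^ n) F (j%:R * mesh n) =
   (mesh (n + p))%:C *: \sum_(0 <= i < 4 * 2 ^ n)
      \sum_(i * 2 ^ p <= j < i.+1 * 2 ^ p) F (i%:R * mesh n).
  have mp : mesh n = mesh (n + p) * (2 ^ p)%:R.
    by rewrite /mesh exprD natrX; field; rewrite !expf_neq0.
  rewrite {1}mp rmorphM -scalerA scaler_sumr; congr (_ *: _); apply: eq_bigr => i _.
  rewrite sumr_const_nat mulSn addnK -[RHS]scaler_nat; congr (_ *: _).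
  by rewrite rmorph_nat.
rewrite -scalerBr -sumrB rnormZr ger0_norm ?mesh_ge0//.
have le : rnorm (\sum_(0 <= i < 4 * 2 ^ n)
     (\sum_(i * 2 ^ p <= j < i.+1 * 2 ^ p) F (j%:R * mesh (n + p)) -
      \sum_(i * 2 ^ p <= j < i.+1 * 2 ^ p) F (i%:R * mesh n))) <=
     (e * (2 ^ p)%:R) * (4 * 2 ^ n)%:R.
  apply: sum_rnorm_le => i _; rewrite -sumrB.
  apply: le_trans (rnorm_sum _ _ _) _.
  have -> : e * (2 ^ p)%:R = \sum_(i * 2 ^ p <= j < i.+1 * 2 ^ p) e.
    by rewrite sumr_const_nat mulSn addnK mulr_natr.
  rewrite big_nat_cond [leRHS]big_nat_cond.
  apply: ler_sum => j /andP[/andP[ij ji] _]; apply/ltW/Fd.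
  have -> : i%:R * mesh n = (i * 2 ^ p)%:R * mesh (n + p).
    rewrite /mesh exprD natrM natrX; field; rewrite !expf_neq0//.
  rewrite -mulrBl normrM (ger0_norm (mesh_ge0 _)) -natrB// normr_nat.
  apply: lt_trans nd.
  rewrite (_ : mesh n = (2 ^ p)%:R * mesh (n + p)); last first.
    by rewrite /mesh exprD natrX; field; rewrite !expf_neq0.
  by rewrite ltr_pM2r ?mesh_gt0// ltr_nat ltn_subLR// -mulSnr.
apply: le_trans (ler_wpM2l (mesh_ge0 _) le) _.
rewrite (_ : mesh _ * _ = (mesh (n + p) * (2 ^ (n + p))%:R) * (4 * e)); last first.
  by rewrite expnD !natrM; ring.
by rewrite mesh_pow mul1r.
Qed.

Lemma rsum_cvg (a b : R) F : continuous F -> supported a b F ->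
  cvg (rsum n F @[n --> \oo]).
Proof.
move=> cF sF; apply: cauchy_cvg; apply/cauchyP => -[e c].
rewrite ltcE/= => /andP[/eqP-> e0].
have e5 : 0 < e / 5 by rewrite divr_gt0.
have [d d0 Fd] := supported_unif cF sF e5.
have [n _ nd] : \forall n \near \oo, `|0 - mesh n| < d.
  by move/cvgrPdist_lt : mesh_cvg; exact.
have {nd} := nd n (leqnn n); rewrite sub0r normrN ger0_norm ?mesh_ge0// => nd.
exists (rsum n F); exists n => // m /= nm; rewrite -ball_normE/= rnormE ltcR rnormB.
rewrite -(subnKC nm); apply: le_lt_trans (rsum_refine _ nd Fd) _; lra.
Qed.

Definition rint F : V := lim (rsum n F @[n --> \oo]).

Definition rintegrable F : Prop := cvg (rsum n F @[n --> \oo]).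

Lemma rintB F G : rintegrable F -> rintegrable G ->
  rintegrable (fun x => F x - G x) /\
  rint (fun x => F x - G x) = rint F - rint G.
Proof.
move=> iF iG; have h : rsum n (fun x => F x - G x) @[n --> \oo] --> rint F - rint G.
  by under eq_cvg do rewrite rsumB; apply: cvgB.
by split; [exact: cvgP h|apply: cvg_lim h; exact: norm_hausdorff].
Qed.

Lemma rint_le F (M : R) : rintegrable F -> (forall x, rnorm (F x) <= M) ->
  rnorm (rint F) <= 4 * M.
Proof.
move=> iF FM.
have h : rnorm (rsum n F) @[n --> \oo] --> rnorm (rint F) by exact: cvg_rnorm.
by apply: (cvgr_to_le h); apply: nearW => n; exact: rsum_le.
Qed.

(** Operators that commute with the Riemann sums commute with the integral. *)
Lemma rint_op (f : V -> V) F : linear f -> continuous f -> rintegrable F ->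
  rintegrable (f \o F) /\ rint (f \o F) = f (rint F).
Proof.
move=> lf cf iF; have h : rsum n (f \o F) @[n --> \oo] --> f (rint F).
  have fZD c v w : f (c *: v + w) = c *: f v + f w by exact: lf.
  have f0 : f 0 = 0.
    have := fZD 1 0 0; rewrite !scale1r addr0 => /esym/eqP.
    by rewrite -subr_eq0 addrK => /eqP.
  have fs n : rsum n (f \o F) = f (rsum n F).
    rewrite /rsum -[X in f X]addr0 fZD f0 addr0; congr (_ *: _).
    elim: (4 * 2 ^ n)%N => [|m IH]; first by rewrite !big_geq.
    rewrite !big_nat_recr//= IH.
    by have := fZD 1 (\sum_(0 <= j < m) F (j%:R * mesh n)) (F (m%:R * mesh n)); rewrite !scale1r.
  by under eq_cvg do rewrite fs; apply: (cvg_comp _ _ iF); exact: cf.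
by split; [exact: cvgP h|apply: cvg_lim h; exact: norm_hausdorff].
Qed.

Lemma sum_shift (f : nat -> V) (M k : nat) : (forall j, (j < k)%N -> f j = 0) ->
  (forall j, (M <= j)%N -> f j = 0) ->
  \sum_(0 <= j < M) f (j + k)%N = \sum_(0 <= j < M) f j.
Proof.
move=> f0 f1; have e1 : \sum_(0 <= j < M + k) f j = \sum_(0 <= j < M) f (j + k)%N.
  rewrite (@big_cat_nat _ _ _ k)//= ?leq_addl// big_nat_cond big1 ?add0r; last first.
    by move=> j /andP[/andP[_ jk] _]; exact: f0.
  by rewrite -{1}[k]add0n big_addn addnK.
rewrite -e1 (@big_cat_nat _ _ _ M)//= ?leq_addr// [X in _ + X]big_nat_cond
  [X in _ + X]big1 ?addr0//.
by move=> j /andP[/andP[Mj _] _]; exact: f1.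
Qed.

Lemma shift_continuous F (h : R) : continuous F -> continuous (fun x => F (x + h)).
Proof.
move=> cF x; apply: (@cvg_comp _ _ _ (fun x => x + h) F); last exact: cF.
by apply: cvgD; [exact: cvg_id|exact: cvg_cst].
Qed.

(** The sums are invariant under the shifts by multiples of the step, and h is
    approximated by such a multiple with an error less than the step. *)
Lemma rint_shift F (h : R) : 0 <= h <= 1 -> continuous F -> supported 1 3 F ->
  rint (fun x => F (x + h)) = rint F.
Proof.
move=> /andP[h0 h1] cF sF.
have iF := rsum_cvg cF sF.
have sG : supported (1 - h) (3 - h) (fun x => F (x + h)).
  by move=> x x13; apply: sF; case: x13 => ?; [left|right]; lra.
have [iD rD] := rintB (rsum_cvg (@shift_continuous _ h cF) sG) iF.
apply/eqP; rewrite -subr_eq0 -rD; apply/eqP.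
apply: cvg_lim; first exact: norm_hausdorff.
apply/cvg_rnormP => e e0; have e5 : 0 < e / 5 by rewrite divr_gt0.
have [d d0 Fd] := supported_unif cF sF e5.
have md : \forall n \near \oo, `|0 - mesh n| < d.
  by move/cvgrPdist_lt : mesh_cvg; exact.
move: md; apply: filterS => n; rewrite sub0r normrN ger0_norm ?mesh_ge0// => nd.
rewrite subr0 rsumB; pose k := Num.trunc (h * 2 ^+ n).
have p0 : 0 < 2 ^+ n :> R by rewrite exprn_gt0.
have /andP[k1 k2] : k%:R <= h * 2 ^+ n < k.+1%:R.
  by apply: Num.Theory.truncn_itv; rewrite mulr_ge0// ltW.
have kn : (k <= 2 ^ n)%N.
  by rewrite -(ler_nat R) natrX (le_trans k1)// ler_piMl// ltW.
have -> : rsum n F = (mesh n)%:C *: \sum_(0 <= j < 4 * 2 ^ n) F ((j + k)%:R * mesh n).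
  rewrite /rsum (sum_shift (f := fun j => F (j%:R * mesh n)))// => j jk.
    apply: sF; left; rewrite /mesh ltr_pdivrMr// mul1r -natrX ltr_nat.
    exact: leq_trans jk kn.
  apply: sF; right; rewrite /mesh ltr_pdivlMr// -natrX -natrM ltr_nat.
  by apply: leq_trans jk; rewrite ltn_pmul2r// expn_gt0.
rewrite /rsum -scalerBr -sumrB rnormZr ger0_norm ?mesh_ge0//.
apply: (@le_lt_trans _ _ (mesh n * (e / 5 * (4 * 2 ^ n)%:R))).
  rewrite ler_wpM2l ?mesh_ge0//; apply: sum_rnorm_le => j _; apply/ltW/Fd.
  rewrite natrD mulrDl opprD addrACA subrr add0r.
  have -> : h - k%:R * mesh n = (h * 2 ^+ n - k%:R) * mesh n.
    by rewrite /mesh; field; rewrite gt_eqF.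
  rewrite normrM (ger0_norm (mesh_ge0 _)) (le_lt_trans _ nd)//.
  rewrite ler_piMl ?mesh_ge0// ger0_norm ?subr_ge0//.
  by move: k2; rewrite -natr1; lra.
rewrite natrM (_ : mesh n * _ = (mesh n * (2 ^ n)%:R) * (4 * (e / 5))); last by ring.
by rewrite mesh_pow mul1r; lra.
Qed.

End RiemannSums.

Arguments rsum_cvg {R V a b F} _ _.
Arguments shift_continuous {R V F} h _.

(** * Smoothing vectors along one-parameter groups *)

Section Smearing.
Context {R : realType} {E : hilbert R}.
Implicit Types (T : R -> E -> E) (u v w a : E) (f g : R -> R).

Definition isom_group T : Prop :=
  [/\ forall s, linear (T s), forall s v, rnorm (T s v) = rnorm v,
      forall v, T 0 v = v, forall s r v, T (s + r) v = T s (T r v) &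
      forall v, continuous (T^~ v)].

Definition is_gen T v a : Prop :=
  (h%:C)^-1 *: (T h v - v) @[h --> (0 : R)^'] --> a.

Definition smear T f v : E := rint (fun s => (f s)%:C *: T s v).

Lemma isom_groupB T s v w : isom_group T -> T s (v - w) = T s v - T s w.
Proof.
case=> lT _ _ _ _; have := lT s (-1) w v.
by rewrite !scaleN1r [- w + v]addrC => ->; rewrite addrC.
Qed.

Lemma isom_group_continuous T s : isom_group T -> continuous (T s).
Proof.
move=> gT v; apply/cvg_rnormP => e e0; have [_ iT _ _ _] := gT.
have vv : id w @[w --> v] --> v by exact: cvg_id.
move/cvg_rnormP : vv => /(_ e e0).
by apply: filterS => w; rewrite -isom_groupB// iT.
Qed.

Lemma isom_group_scale T (k : R) : isom_group T -> isom_group (fun s => T (k * s)).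
Proof.
move=> [lT iT T0 TD cT]; split=> [s|s v|v|s r v|v x].
- exact: lT.
- exact: iT.
- by rewrite mulr0.
- by rewrite mulrDr.
apply: (@cvg_comp _ _ _ (fun s => k * s) (T^~ v)); last exact: cT.
by apply: cvgMr; exact: cvg_id.
Qed.

Lemma is_gen_scale T (k : R) v a : k != 0 ->
  is_gen (fun s => T (k * s)) v a -> is_gen T v ((k^-1)%:C *: a).
Proof.
move=> k0 va; have k10 : k^-1 != 0 by rewrite invr_eq0.
have := cvg_comp _ _ (cvg_dnbhs0_scale k10) va.
rewrite /is_gen => h.
rewrite (_ : (fun h => _) = (fun h : R => (k^-1)%:C *: (((k^-1 * h)%:C)^-1 *: (T h v - v)))).
  apply: cvgZl_tmp; apply: cvg_trans h; apply: near_eq_cvg; apply: nearW => s /=.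
  by rewrite mulVKf.
apply/funext => s; rewrite scalerA; congr (_ *: _).
by rewrite rmorphM/= invfM mulrA divff ?mul1r// -(rmorph0 (real_complex R)) (inj_eq (@complexI R)).
Qed.

Lemma integrand_continuous T f v : isom_group T -> continuous f ->
  continuous (fun s => (f s)%:C *: T s v).
Proof. by move=> [_ _ _ _ cT] cf s; apply: cvgZ_real; [exact: cf|exact: cT]. Qed.

Lemma test_supported T f v : test f -> supported 1 2 (fun s => (f s)%:C *: T s v).
Proof. by move=> [_ f0] s /f0 ->; rewrite scale0r. Qed.

Lemma smear_integrable T f v : isom_group T -> test f ->
  rintegrable (fun s => (f s)%:C *: T s v).
Proof.
move=> gT tf; apply: (@rsum_cvg _ _ 1 2); last exact: test_supported.
by apply: integrand_continuous => //; exact: test_continuous.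
Qed.

Lemma test_unif f : test f -> forall e, 0 < e -> exists2 d, 0 < d &
  forall x y, `|x - y| < d -> `|f x - f y| < e.
Proof.
move=> tf e e0; pose F x : R[i]^o := (f x)%:C *: (1 : R[i]^o).
have cF : continuous F.
  move=> x; apply: cvgZ_real; last exact: cvg_cst.
  exact: test_continuous.
have sF : supported 1 2 F by move=> x x12; rewrite /F (tf.2 _ x12) scale0r.
have [d d0 dF] := supported_unif cF sF e0; exists d => // x y /dF.
by rewrite /F -scalerBl -rmorphB/= rnormZr /rnorm normr1 mulr1.
Qed.

(** By the mean value theorem. *)
Lemma test_quot f f' : (forall x : R, is_derive x 1 f (f' x)) -> test f' ->
  forall e, 0 < e -> exists2 d, 0 < d &
  forall h, h != 0 -> `|h| < d -> forall s, `|h^-1 * (f (s - h) - f s) + f' s| <= e.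
Proof.
move=> ff' tf' e e0; have [d d0 df'] := test_unif tf' e0.
exists d => // h h0 hd s.
have cf : continuous f.
  move=> x; apply/differentiable_continuous/derivable1_diffP.
  by have := ff' x; case.
have [z zs fz] : exists2 z, `|z - s| < d & f (s - h) - f s = - h * f' z.
  have [hlt|hgt|heq] := ltgtP 0 h; last by rewrite -heq eqxx in h0.
    have lt1 : s - h < s by lra.
    have [z zi fz] := MVT lt1 (fun x _ => ff' x) (continuous_subspaceT cf).
    exists z; last by rewrite -opprB fz; ring.
    move: zi; rewrite in_itv/= => /andP[z1 z2].
    by move: hd; rewrite gtr0_norm// ltr_norml => hd; apply/andP; split; lra.
  have lt1 : s < s - h by lra.
  have [z zi fz] := MVT lt1 (fun x _ => ff' x) (continuous_subspaceT cf).
  exists z; last by rewrite fz; ring.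
  move: zi; rewrite in_itv/= => /andP[z1 z2].
  by move: hd; rewrite ltr0_norm// ltr_norml => hd; apply/andP; split; lra.
rewrite fz (_ : _ + _ = f' s - f' z); last by field.
by apply/ltW/df'; rewrite distrC.
Qed.

(** As [rint_shift] only moves the argument forward, it is applied to the
    integrand of the right or of the left side according to the sign of h. *)
Lemma smear_shift T f v h : isom_group T -> test f -> `|h| <= 1 ->
  T h (smear T f v) = rint (fun s => (f (s - h))%:C *: T s v).
Proof.
move=> gT tf h1; have [lT _ _ TD _] := gT.
have cf := test_continuous tf.
have [_ <-] := rint_op (lT h) (@isom_group_continuous _ h gT) (@smear_integrable _ _ v gT tf).
have e1 s : T h ((f s)%:C *: T s v) = (f s)%:C *: T (s + h) v.
  rewrite addrC TD; have := lT h (f s)%:C (T s v) 0.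
  have T00 : T h 0 = 0 by have := isom_groupB h 0 0 gT; rewrite !subrr.
  by rewrite T00 !addr0.
have [h0|h0] := leP 0 h.
  rewrite -(@rint_shift _ _ (fun s => (f (s - h))%:C *: T s v) h).
  - by congr rint; apply/funext => s /=; rewrite e1 addrK.
  - by rewrite h0 -(ger0_norm h0).
  - apply: integrand_continuous => // x; apply: (@cvg_comp _ _ _ (fun x => x - h) f).
      by apply: cvgB; [exact: cvg_id|exact: cvg_cst].
    exact: cf.
  - by move=> x x13; rewrite tf.2 ?scale0r//; move: h1; rewrite ger0_norm// => h1; case: x13 => ?; [left|right]; lra.
rewrite -(@rint_shift _ _ (T h \o (fun s => (f s)%:C *: T s v)) (- h)).
- by congr rint; apply/funext => s /=; rewrite e1 addrNK.
- by move: h1; rewrite ltr0_norm// => ->; rewrite oppr_ge0 ltW.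
- move=> x; apply: (@cvg_comp _ _ _ _ (T h)); last exact: isom_group_continuous.
  exact: integrand_continuous.
- move=> x x13 /=; rewrite e1 tf.2 ?scale0r//; case: x13 => ?; [left|right]; lra.
Qed.

(** Integration by parts: the group translates the test function. *)
Lemma smear_gen T f f' v : isom_group T -> test f ->
  (forall x : R, is_derive x 1 f (f' x)) -> test f' ->
  is_gen T (smear T f v) (smear T (fun x => f' x * -1) v).
Proof.
move=> gT tf ff' tf'; have [lT iT _ TD cT] := gT.
have tn : test (fun x => f' x * -1) by apply: testM => // n; exact: diff_n_cst.
apply/cvg_rnormP => e e0.
pose M := 1 + rnorm v; have M0 : 0 < M by rewrite ltr_pwDl// rnorm_ge0.
(* The interval of summation has length 4. *)
pose e' := e / (5 * M); have e'0 : 0 < e' by rewrite divr_gt0// mulr_gt0.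
have [d d0 fd] := test_quot ff' tf' e'0.
near=> h.
have h0 : h != 0 by near: h; exact: near_dnbhs0_neq.
have h1 : `|h| <= 1 by near: h; exact: dnbhs0_le.
have hd : `|h| < d by near: h; exact: dnbhs0_lt.
pose F s := (f (s - h))%:C *: T s v.
have cF : continuous F.
  apply: integrand_continuous => // x.
  apply: (@cvg_comp _ _ _ (fun x => x - h) f); last exact: test_continuous.
  by apply: cvgB; [exact: cvg_id|exact: cvg_cst].
have iF : rintegrable F.
  apply: (@rsum_cvg _ _ (1 + h) (2 + h)) => // x x12; rewrite /F tf.2 ?scale0r//.
  by case: x12 => ?; [left|right]; lra.
have iq := rintB iF (@smear_integrable _ _ v gT tf).
have lq : linear (fun w : E => (h^-1)%:C *: w).
  by move=> c w w'; rewrite scalerDr !scalerA mulrC.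
have cq : continuous (fun w : E => (h^-1)%:C *: w).
  by move=> w; apply: cvgZl_tmp; exact: cvg_id.
have [iq1 iq2] := rint_op lq cq iq.1.
have [iq3 iq4] := rintB iq1 (@smear_integrable _ _ v gT tn).
rewrite (smear_shift v gT tf h1) -/F -fmorphV -iq.2 -iq2 -iq4.
apply: le_lt_trans (_ : 4 * (e' * rnorm v) < e).
  apply: rint_le => // s /=; rewrite /F -scalerBl scalerA -scalerBl.
  rewrite -rmorphB/= -rmorphM/= -rmorphB/= rnormZr iT.
  by rewrite ler_wpM2r ?rnorm_ge0// mulrN1 opprK fd.
apply: (@le_lt_trans _ _ (4 * (e' * M))).
  by rewrite ler_wpM2l// ler_wpM2l ?(ltW e'0)// /M lerDr.
rewrite /e' (_ : 4 * _ = e * (4 / 5)); last by field; rewrite gt_eqF.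
by rewrite gtr_pMr//; lra.
Unshelve. all: by end_near. Qed.

(** A Riemann sum of the test function stands for its integral. *)
Definition rmean n f : R := mesh n * \sum_(0 <= j < 4 * 2 ^ n) f (j%:R * mesh n).

Lemma rsum_cst n f v : rsum n (fun s => (f s)%:C *: v) = (rmean n f)%:C *: v.
Proof.
rewrite /rsum /rmean rmorphM/= -scalerA; congr (_ *: _).
rewrite [X in X%:C](_ : _ = \sum_(0 <= j < 4 * 2 ^ n) f (j%:R * mesh n))// rmorph_sum/=.
by rewrite scaler_suml.
Qed.

Lemma rmean_ge n f c : (forall x, 0 <= f x) -> 0 < c ->
  (forall x, 5 / 4 <= x <= 7 / 4 -> c <= f x) -> c / 2 <= rmean n.+2 f.
Proof.
move=> f0 c0 fc; rewrite /rmean.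
have p0 : 0 < 2 ^+ n :> R by rewrite exprn_gt0.
have sub : c * (2 * 2 ^ n)%:R <= \sum_(0 <= j < 4 * 2 ^ n.+2) f (j%:R * mesh n.+2).
  rewrite (@big_cat_nat _ _ _ (5 * 2 ^ n))//=; last by rewrite !expnS !mulnA leq_mul2r orbT.
  rewrite (@big_cat_nat _ _ _ (7 * 2 ^ n) (5 * 2 ^ n))//=; last 2 first.
  - by rewrite leq_mul2r orbT.
  - by rewrite !expnS !mulnA leq_mul2r orbT.
  rewrite -[leLHS]add0r lerD ?sumr_ge0// -[leLHS]addr0 lerD ?sumr_ge0//.
  have -> : c * (2 * 2 ^ n)%:R = \sum_(5 * 2 ^ n <= j < 7 * 2 ^ n) c.
    by rewrite sumr_const_nat -mulnBl mulr_natr.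
  apply: ler_sum_nat => j /andP[j1 j2]; apply: fc.
  have -> : j%:R * mesh n.+2 = (j%:R / 2 ^+ n) / 4 :> R.
    by rewrite /mesh !exprS; field; rewrite gt_eqF.
  rewrite !ler_pM2r ?invr_gt0// ler_pdivlMr// ler_pdivrMr// -!natrX -!natrM !ler_nat.
  by rewrite j1 ltnW.
apply: le_trans (ler_wpM2l (mesh_ge0 _) sub).
rewrite (_ : mesh _ * _ = c / 2)// /mesh !exprS natrM natrX.
by field; rewrite gt_eqF.
Qed.

Lemma test_bounded f : test f -> exists2 B, 0 < B & forall x, `|f x| <= B.
Proof.
move=> tf; have cf : continuous (fun x => `|f x|).
  by move=> x; apply: cvg_norm; exact: test_continuous.
have [x _ fx] := EVT_max (ler1n R 2) (continuous_subspaceT cf).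
exists (1 + `|f x|); first by rewrite ltr_pwDl.
move=> y; have [y12|] := boolP (y \in `[1, 2]).
  by rewrite (le_trans (fx y y12))// lerDr.
rewrite in_itv/= negb_and -!ltNge => /orP y12.
by rewrite tf.2// normr0 addr_ge0.
Qed.

Lemma smearZ T f (c : R) v : isom_group T -> test f ->
  smear T (fun x => f x * c) v = c%:C *: smear T f v.
Proof.
move=> gT tf.
have lq : linear (fun w : E => c%:C *: w).
  by move=> x w w'; rewrite scalerDr !scalerA mulrC.
have cq : continuous (fun w : E => c%:C *: w).
  by move=> w; apply: cvgZl_tmp; exact: cvg_id.
have [_ <-] := rint_op lq cq (@smear_integrable _ _ v gT tf).
by congr rint; apply/funext => s /=; rewrite scalerA rmorphM mulrC.
Qed.

(** Test functions concentrated near 0 give vectors close to the given one; the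
    concentration is obtained by scaling the parameter of the group. *)
Lemma smear_approx T v e : isom_group T -> 0 < e -> exists f k,
  [/\ test f, k != 0 & rnorm (smear (fun s => T (k * s)) f v - v) < e].
Proof.
move=> gT e0; have [lT iT T0 TD cT] := gT.
have [f [tf f0 [c c0 fc]]] := @test_bump R.
have gid : isom_group (fun (_ : R) (w : E) => w).
  by split=> // w s; exact: cvg_cst.
have iz := @smear_integrable _ _ v gid tf.
pose z := smear (fun (_ : R) (w : E) => w) f v.
pose e1 := c / 2 * (e / 2).
have e10 : 0 < e1 by rewrite mulr_gt0// divr_gt0.
(* Dividing f by a fine Riemann sum r normalizes its integral up to a small
   error; r is at least c / 2. *)
have [n nz] : exists n, rnorm (rsum n.+2 (fun s => (f s)%:C *: v) - z) < e1.
  have /cvg_rnormP/(_ e1 e10) [N _ NP] : rsum n (fun s => (f s)%:C *: v) @[n --> \oo] --> z.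
    exact: iz.
  by exists N; apply: NP => /=; rewrite -addn2 leq_addr.
rewrite rsum_cst in nz.
have cn := @rmean_ge n f c f0 c0 fc.
move: (rmean n.+2 f) nz cn => r nz rc.
have r0 : 0 < r by apply: lt_le_trans rc; rewrite divr_gt0.
have [B B0 fB] := test_bounded tf.
pose e2 := e1 / (5 * B).
have e20 : 0 < e2 by rewrite divr_gt0// mulr_gt0.
have /cvg_rnormP/(_ e2 e20)/nbhs_ballP[d /= d0 dT] := cT v 0.
have k0 : d / 3 != 0 by rewrite mulf_neq0// gt_eqF.
exists (fun x => f x * r^-1), (d / 3); split=> //.
  by apply: testM => // m; exact: diff_n_cst.
have gk := @isom_group_scale _ (d / 3) gT.
rewrite smearZ//.
have near_z : rnorm (smear (fun s => T (d / 3 * s)) f v - z) < e1.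
  have [_ <-] := rintB (@smear_integrable _ _ v gk tf) iz.
  apply: (@le_lt_trans _ _ (4 * (B * e2))).
    apply: rint_le.
      by have [] := rintB (@smear_integrable _ _ v gk tf) iz.
    move=> s; rewrite -scalerBr rnormZr.
    have [s12|] := boolP (s \in `[1, 2]).
      apply: ler_pM => //; first exact: rnorm_ge0.
      apply/ltW; have := dT (d / 3 * s); rewrite T0; apply.
      move: s12; rewrite in_itv/= /ball/= sub0r normrN => /andP[s1 s2].
      by rewrite ger0_norm ?mulr_ge0 ?divr_ge0 ?(ltW d0)//; nra.
    rewrite in_itv/= negb_and -!ltNge => /orP s12.
    by rewrite tf.2// normr0 mul0r mulr_ge0 ?ltW.
  rewrite /e2 (_ : 4 * _ = e1 * (4 / 5)); last by field; rewrite gt_eqF.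
  by rewrite gtr_pMr//; lra.
move: (smear _ f v) near_z => w wz.
have -> : (r^-1)%:C *: w - v = (r^-1)%:C *: (w - r%:C *: v).
  by rewrite scalerBr scalerA -rmorphM/= mulVf ?gt_eqF// scale1r.
rewrite rnormZr ger0_norm ?invr_ge0 ?ltW// mulrC ltr_pdivrMr//.
apply: le_lt_trans (rnormBB _ _ z) _; rewrite (rnormB z).
apply: (@lt_le_trans _ _ (e1 + e1)); first exact: ltrD.
rewrite (_ : e1 + e1 = e * (c / 2)); last by rewrite /e1; field.
by rewrite ler_pM2l.
Qed.

End Smearing.

Arguments smear_gen {R E T f f'} v _ _ _ _.
Arguments is_gen_scale {R E T k v a} _ _.
Arguments smear_approx {R E T} v {e} _ _.

(** * Density of the core *)

Section Garding.
Context {R : realType} {E : hilbert R} (pi : axb R -> E -> E).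
Context (hpi : unitary_rep pi).
Implicit Types (u v w a c : E) (f g : R -> R).

Lemma transop_group : isom_group (transop pi).
Proof.
split=> [s|s v|v|s r v|v s].
- exact: transop_linear.
- exact: rep_rnorm.
- exact: transop0.
- exact: transopD.
have s0 : (x, 0) @[x --> s] --> ((s, 0) : R * R).
  exact: (cvg_pair (@cvg_id _ (nbhs s)) (@cvg_cst R (0 : R) _ (nbhs s) _)).
exact: (rep_cvg hpi s0 (cvg_cst v)).
Qed.

Lemma dilop_group : isom_group (dilop pi).
Proof.
split=> [s|s v|v|s r v|v s].
- exact: dilop_linear.
- exact: rep_rnorm.
- exact: dilop0.
- exact: dilopD.
have s0 : (0, x) @[x --> s] --> ((0, s) : R * R).
  exact: (cvg_pair (@cvg_cst R (0 : R) _ (nbhs s) _) (@cvg_id _ (nbhs s))).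
exact: (rep_cvg hpi s0 (cvg_cst v)).
Qed.

(** Dilations rescale the generator of the translations, which turns into a
    multiplication of the test function by an exponential. *)
Lemma smear_dilop_genA (k : R) f u a : test f -> genA pi u a ->
  genA pi (smear (fun s => dilop pi (k * s)) f u)
    (smear (fun s => dilop pi (k * s)) (fun s => f s * expR (- k * s)) a).
Proof.
move=> tf ua.
have gT := @isom_group_scale _ _ _ k dilop_group.
have tf' : test (fun s => f s * expR (- k * s)) by apply: testM => // n; exact: diff_n_expR.
have [B B0 fB] := test_bounded tf.
pose K := expR (2 * `|k|); have K0 : 0 < K by exact: expR_gt0.
have kK s : s \in `[1, 2] -> expR (- k * s) <= K.
  rewrite in_itv/= => /andP[s1 s2]; rewrite ler_expR.
  rewrite (le_trans (ler_norm _))// normrM normrN mulrC ler_wpM2r//.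
  by rewrite ger0_norm//; lra.
apply/cvg_rnormP => e e0.
pose e' := e / (5 * (B * K)).
have e'0 : 0 < e' by rewrite divr_gt0// mulr_gt0// mulr_gt0.
have /cvg_rnormP/(_ e' e'0) := ua.
rewrite near_withinE => /nbhs_ballP[d /= d0 da].
near=> t.
have t0 : t != 0 by near: t; exact: near_dnbhs0_neq.
have td : `|t| < d / K by near: t; apply: dnbhs0_lt; rewrite divr_gt0.
have iu := @smear_integrable _ _ _ _ u gT tf.
have ia := @smear_integrable _ _ _ _ a gT tf'.
have lt : linear (transop pi t) by exact: transop_linear.
have ct : continuous (transop pi t) by exact: (@isom_group_continuous _ _ _ t transop_group).
have [i1 <-] := rint_op lt ct iu.
have [i2 <-] := rintB i1 iu.
have lq : linear (fun w : E => (t%:C)^-1 *: w).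
  by move=> c w w'; rewrite scalerDr !scalerA mulrC.
have cq : continuous (fun w : E => (t%:C)^-1 *: w).
  by move=> w; apply: cvgZl_tmp; exact: cvg_id.
have [i3 <-] := rint_op lq cq i2.
have [i4 <-] := rintB i3 ia.
apply: (@le_lt_trans _ _ (4 * (B * (K * e')))).
  apply: rint_le => // s /=.
  have [s12|] := boolP (s \in `[1, 2]); last first.
    rewrite in_itv/= negb_and -!ltNge => /orP s12.
    rewrite tf.2// mul0r !scale0r /transop (rep0 hpi) !subrr scaler0 subr0 rnorm0.
    by rewrite mulr_ge0 ?(ltW B0)// mulr_ge0 ?ltW.
  pose tau := expR (- k * s) * t.
  have tau0 : tau != 0 by rewrite mulf_neq0// gt_eqF// expR_gt0.
  have taud : `|tau| < d.
    rewrite /tau normrM ger0_norm ?expR_ge0//.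
    apply: (@le_lt_trans _ _ (K * `|t|)); first by rewrite ler_wpM2r// kK.
    by rewrite mulrC -ltr_pdivlMr.
  have uV : transop pi t (dilop pi (k * s) u) = dilop pi (k * s) (transop pi tau u).
    by rewrite (dilop_transop hpi) /tau mulrA -expRD mulNr subrr expR0 mul1r.
  rewrite (_ : _ - _ = (f s)%:C *: dilop pi (k * s) ((expR (- k * s))%:C *:
      ((tau%:C)^-1 *: (transop pi tau u - u) - a))); last first.
    rewrite [transop pi t _](_ : _ = (f s)%:C *: transop pi t (dilop pi (k * s) u)); last first.
      by rewrite /transop (repZ hpi).
    rewrite uV -scalerBr scalerA [_^-1 * _]mulrC -scalerA rmorphM -scalerA -scalerBr.
    congr (_ *: _); rewrite /dilop (repZ hpi) (repB hpi) (repZ hpi) (repB hpi) [RHS]scalerBr.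
    rewrite [in RHS]scalerA.
    congr (_ *: _ - _).
    rewrite /tau rmorphM invfM mulrA divff ?mul1r//.
    by rewrite -(rmorph0 (real_complex R)) (inj_eq (@complexI R)) gt_eqF// expR_gt0.
  rewrite rnormZr; apply: ler_pM => //; first exact: rnorm_ge0.
  rewrite (rep_rnorm hpi) rnormZr ger0_norm ?expR_ge0//.
  apply: ler_pM; rewrite ?expR_ge0 ?rnorm_ge0 ?kK//.
  by apply/ltW/da; rewrite /ball/= ?sub0r ?normrN.
rewrite /e' (_ : 4 * _ = e * (4 / 5)); last by field; rewrite !gt_eqF.
by rewrite gtr_pMr//; lra.
Unshelve. all: by end_near. Qed.

(** The translations are integrated first: by [smear_dilop_genA], the outer
    integral over the dilations preserves the domain of their generator. *)
Definition garding_vector (k l : R) f g v : E :=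
  smear (fun s => dilop pi (l * s)) g (smear (fun s => transop pi (k * s)) f v).

Lemma garding_core (k l : R) f g v : k != 0 -> l != 0 -> test f -> test g ->
  core pi (garding_vector k l f g v).
Proof.
move=> k0 l0 tf tg n; elim: n f g tf tg => //= n IH f g tf tg.
have gk := @isom_group_scale _ _ _ k transop_group.
have gl := @isom_group_scale _ _ _ l dilop_group.
have neg (h : R -> R) : test h -> test (fun x => h x * -1).
  by move=> th; apply: testM => // m; exact: diff_n_cst.
have scal h (x : R) : test h -> test (fun y => h y * x).
  by move=> th; apply: testM => // m; exact: diff_n_cst.
have [f' ff' tf'] := test_derive tf; have [g' gg' tg'] := test_derive tg.
have fA := is_gen_scale k0 (smear_gen v gk tf ff' tf').
have gC := is_gen_scale l0 (smear_gen (smear (fun s => transop pi (k * s)) f v) gl tg gg' tg').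
rewrite -smearZ// in fA; last exact: neg.
rewrite -smearZ// in gC; last exact: neg.
have gA := @smear_dilop_genA l _ _ _ tg fA.
exists (garding_vector k l (fun x => f' x * -1 * k^-1) (fun s => g s * expR (- l * s)) v).
exists (garding_vector k l f (fun x => g' x * -1 * l^-1) v).
split=> //.
  apply: IH; first by apply: scal; exact: neg.
  by apply: testM => // m; exact: diff_n_expR.
by apply: IH => //; apply: scal; exact: neg.
Qed.

(** Garding's theorem for the ax+b group. Each of the two integrals moves the
    vector by less than e / 2. *)
Lemma core_dense v e : 0 < e -> exists2 w, core pi w & rnorm (w - v) < e.
Proof.
move=> e0; have e2 : 0 < e / 2 by rewrite divr_gt0.
have [f [k [tf k0 fk]]] := smear_approx v transop_group e2.
have [g [l [tg l0 gl]]] := smear_approx (smear (fun s => transop pi (k * s)) f v) dilop_group e2.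
exists (garding_vector k l f g v); first exact: garding_core.
apply: le_lt_trans (rnormBB _ _ (smear (fun s => transop pi (k * s)) f v)) _.
by rewrite (splitr e) ltrD.
Qed.

End Garding.

(** * The amplified representation and its reflection *)

Section Amplification.
Context {R : realType} {H : hilbert R} (pic : axb R -> H -> H).
Context (hpic : unitary_rep pic).
Let E : hilbert R := l2_hilbert H.
Implicit Types (u v w : l2 H) (x y : H).

Lemma sqsummable_isom (F : nat * bool -> H -> H) u :
  (forall i x, rnorm (F i x) = rnorm x) -> (fun i => F i (u i)) \in @sqsummable R H.
Proof.
move=> iF; apply/asboolP; apply: (summable_ext _ (l2_summable u)) => i.
by rewrite /sqnorms iF.
Qed.

(** An endomorphism of the group; the amplified representation is the Hilbert
    sum of the pullbacks of [pic] along these endomorphisms, for all nodes. *)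
Definition axb_scale (k : R) (g : axb R) : axb R := Axb (k * transl g) (dilat g).

Definition ampl (g : axb R) (u : E) : E :=
  L2 (sqsummable_isom u (fun i => rep_rnorm hpic (axb_scale (node i) g))).

Lemma amplE g u i : (ampl g u : l2 H) i = pic (axb_scale (node i) g) (u i).
Proof. by []. Qed.

Lemma axb_scaleM k g h : axb_scale k (axb_mul g h) = axb_mul (axb_scale k g) (axb_scale k h).
Proof. by apply: axb_eq => //=; ring. Qed.

Lemma ampl_mul g h u : ampl (axb_mul g h) u = ampl g (ampl h u).
Proof.
by apply: l2_eq => i; rewrite !amplE axb_scaleM (rep_mul hpic).
Qed.

Lemma ampl_one u : ampl axb_one u = u.
Proof.
apply: l2_eq => i; rewrite amplE -[RHS](rep_one hpic); congr (pic _ _).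
by apply: axb_eq => //=; rewrite mulr0.
Qed.

Lemma ampl_linear g : linear (ampl g).
Proof. by move=> c u v; apply: l2_eq => i; rewrite amplE; exact: rep_linear. Qed.

Lemma ampl_continuous v (p : R * R) :
  (fun r => ampl (axb_chart r) v : l2 H) @ p --> (ampl (axb_chart p) v : l2 H).
Proof.
apply: (@l2_dominated R H _ (nbhs p) _ _ _ (fun i => 4 * sqnorms v i)) => [r i||i].
- apply: (@le_trans _ _ ((rnorm (v i) + rnorm (v i)) ^+ 2)); last first.
    by rewrite /sqnorms le_eqVlt; apply/orP; left; apply/eqP; ring.
  rewrite lerXn2r ?nnegrE ?addr_ge0 ?rnorm_ge0// !amplE.
  by apply: le_trans (ler_rnormB _ _) _; rewrite !(rep_rnorm hpic).
- by apply: summableZ; exact: l2_summable.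
pose f (r : R * R) : R * R := (node i * r.1, r.2).
have fc : f r @[r --> p] --> f p.
  have f1 : node i * r.1 @[r --> p] --> node i * p.1 by apply: cvgMr; exact: cvg_fst.
  have f2 : r.2 @[r --> p] --> p.2 by exact: cvg_snd.
  exact: (cvg_pair f1 f2).
exact: (rep_cvg hpic fc (@cvg_cst _ (v i) _ (nbhs p) _)).
Qed.

Lemma ampl_rep : unitary_rep (ampl : axb R -> E -> E).
Proof.
split=> [g|||v p].
- split; first exact: ampl_linear.
    by move=> u v; apply: ctotal_ext => i; exact: rep_inner.
  move=> w; exists (ampl (axb_inv g) w).
  rewrite -ampl_mul [axb_mul _ _](_ : _ = axb_one) ?ampl_one//.
  exact: axb_mulgV.
- exact: ampl_one.
- by move=> g h v; exact: ampl_mul.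
exact: ampl_continuous.
Qed.

Lemma phase_rnorm i x : rnorm (phase i *: x) = rnorm x.
Proof. by rewrite rnormZ phase_norm mul1r. Qed.

Lemma theta_subproof u : (fun i => phase i *: u (flip i)) \in @sqsummable R H.
Proof.
apply/asboolP; have := summable_flip (l2_summable u); apply: summable_ext => i.
by rewrite /sqnorms phase_rnorm.
Qed.

(** The reflection exchanges the nodes s and -s, hence reverses the
    translations; the phases enter in view of [pairing_embed]. *)
Definition theta (u : E) : E := L2 (theta_subproof u).

Lemma thetaE u i : (theta u : l2 H) i = phase i *: u (flip i).
Proof. by []. Qed.

Lemma theta_linear : linear theta.
Proof.
move=> c u v; apply: l2_eq => i; rewrite thetaE l2_DE l2_ZE scalerDr !scalerA mulrC.
by rewrite -scalerA.
Qed.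

Lemma thetaK : involutive theta.
Proof.
move=> u; apply: l2_eq => i.
by rewrite !thetaE flipK scalerA phase_mul_flip scale1r.
Qed.

Lemma theta_unitary : unitary_op theta.
Proof.
split; first exact: theta_linear.
  move=> u v; rewrite /= /l2_inner.
  rewrite -(ctotal_flip (fun i => inner H ((u : l2 H) i) ((v : l2 H) i))).
  apply: ctotal_ext => i; rewrite !thetaE innerZl innerZr mulrA phase_conj.
  by rewrite mul1r.
by move=> w; exists (theta w); exact: thetaK.
Qed.

Lemma ampl_RP1 : RP1 theta ampl.
Proof.
move=> g u; apply: l2_eq => i; rewrite thetaE !amplE thetaE flipK (repZ hpic) scalerA.
rewrite phase_mul_flip scale1r; congr (pic _ _); apply: axb_eq => //=.
by rewrite node_flip mulrN mulNr.
Qed.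

Definition coef (k : nat) (i : nat * bool) : R := amp i * node i ^+ k.

Lemma embed_subproof k x : (fun i => (coef k i)%:C *: x) \in @sqsummable R H.
Proof.
apply/asboolP; have := summableZ (rnorm x ^+ 2) (amp_node_summable (R := R) k).
apply: summable_ext => i; by rewrite /sqnorms rnormZr [RHS]exprMn real_normK ?num_real// mulrC.
Qed.

(** A polynomial of degree k in the nodes: the generator of the translations
    acts on the i-th copy of H by [node i] times that of [pic], hence raises the
    degree by one. *)
Definition embed k x : E := L2 (embed_subproof k x).

Lemma embedE k x i : (embed k x : l2 H) i = (coef k i)%:C *: x.
Proof. by []. Qed.

Lemma embed_linear k : linear (embed k).
Proof.
move=> c x y; apply: l2_eq => i; rewrite embedE l2_DE l2_ZE scalerDr !scalerA mulrC.
by rewrite -scalerA.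
Qed.

Lemma embed_rnorm k x : rnorm (embed k x) ^+ 2 =
  total (fun i => coef k i ^+ 2) * rnorm x ^+ 2.
Proof.
rewrite (l2_rnorm_sq (embed k x)) mulrC -totalZ; last exact: amp_node_summable.
apply: total_ext => i; by rewrite /sqnorms embedE rnormZr exprMn real_normK ?num_real// mulrC.
Qed.

Lemma embed_cvg (T : Type) (F : set_system T) (FF : Filter F) k (f : T -> H) x :
  f @ F --> x -> embed k (f t) @[t --> F] --> embed k x.
Proof.
move=> /cvg_rnormP fx; apply/cvg_rnormP => e e0.
pose M := 1 + total (fun i => coef k i ^+ 2).
have M0 : 0 < M.
  by rewrite ltr_pwDl// total_ge0//; [move=> i; exact: sqr_ge0|exact: amp_node_summable].
have := fx (e / M); rewrite divr_gt0// => /(_ isT); apply: filterS => t.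
rewrite ltr_pdivlMr// => ft.
have -> : embed k (f t) - embed k x = embed k (f t - x).
  by rewrite -scaleN1r addrC -embed_linear scaleN1r addrC.
rewrite -(@ltr_pXn2r _ 2) ?nnegrE ?rnorm_ge0 ?(ltW e0)// embed_rnorm.
apply: (@le_lt_trans _ _ ((rnorm (f t - x) * M) ^+ 2)); last first.
  by rewrite ltr_pXn2r ?nnegrE ?(ltW e0)// mulr_ge0 ?rnorm_ge0 ?ltW.
rewrite exprMn mulrC ler_wpM2l ?sqr_ge0// expr2.
have : 0 <= total (fun i => coef k i ^+ 2).
  by apply: total_ge0; [move=> i; exact: sqr_ge0|exact: amp_node_summable].
by rewrite /M; move: (total _) => z z0; nra.
Qed.

End Amplification.

(** * The canonical map *)

Section QuotientMap.
Context {R : realType} {H : hilbert R}.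
Implicit Types (u v w : l2 H) (x y : H).

Lemma rnorm_series_cvg (V : completeNormedModType R[i]) (f : V^nat) :
  cvgn (series (fun n => rnorm (f n))) -> cvgn (series f).
Proof.
move=> /cauchy_cvgP/cauchy_seriesP fc.
apply/cauchy_cvgP/cauchy_seriesP => -[e c]; rewrite ltcE/= => /andP[/eqP-> e0].
have := fc e e0; apply: filterS => n; rewrite ger0_norm ?sumr_ge0//; last first.
  by move=> k _; exact: rnorm_ge0.
by rewrite rnormE ltcR; apply: le_lt_trans; exact: rnorm_sum.
Qed.

Definition qterm u (i : nat * bool) : H := ((phase i)^*%C * (amp i)%:C) *: u i.

Lemma qterm_rnorm u i : rnorm (qterm u i) = amp i * rnorm (u i).
Proof.
rewrite /qterm -scalerA rnormZ normcJ phase_norm mul1r rnormZr.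
by rewrite ger0_norm ?amp_ge0.
Qed.

Definition qbound u : R :=
  total (fun i => 2^-1 * (coef 0 i ^+ 2 + sqnorms u i)).

(** By the inequality of the arithmetic and geometric means, which avoids the
    Cauchy-Schwarz inequality for series. *)
Lemma qterm_le u i : rnorm (qterm u i) <= 2^-1 * (coef 0 i ^+ 2 + sqnorms u i).
Proof.
rewrite qterm_rnorm /coef expr0 mulr1 /sqnorms.
by have := sqr_ge0 (amp i - rnorm (u i)); rewrite sqrrB; lra.
Qed.

Lemma qbound_summable u : summable (fun i => 2^-1 * (coef 0 i ^+ 2 + sqnorms u i)).
Proof.
apply: summableZ; apply: summableD; [exact: amp_node_summable|exact: l2_summable].
Qed.

Lemma qbound_term_ge0 u i : 0 <= 2^-1 * (coef 0 i ^+ 2 + sqnorms u i).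
Proof. by rewrite mulr_ge0// addr_ge0// sqr_ge0. Qed.

Lemma pair_qterm_le u n : rnorm (pairsum (qterm u) n) <=
  pairsum (fun i => 2^-1 * (coef 0 i ^+ 2 + sqnorms u i)) n.
Proof. by rewrite (le_trans (rnormD _ _))// lerD// qterm_le. Qed.

Lemma qsum_cvg u : cvgn (series (pairsum (qterm u))).
Proof.
apply: rnorm_series_cvg.
apply: (@series_le_cvg _ _ (pairsum (fun i => 2^-1 * (coef 0 i ^+ 2 + sqnorms u i)))) => [n|n|n|].
- exact: rnorm_ge0.
- by apply: addr_ge0; exact: qbound_term_ge0.
- exact: pair_qterm_le.
exact: qbound_summable.
Qed.

(** On the polynomials [embed k x], the moments of the weights turn this sum
    into the value i^k x, and the form <theta u, v> into the inner product of
    the values. *)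
Definition qmap (u : l2_hilbert H) : H := limn (series (pairsum (qterm u))).

Lemma qmap_linear : linear qmap.
Proof.
move=> c u v; apply: cvg_lim; first exact: norm_hausdorff.
rewrite (_ : series _ = (fun n => c *: series (pairsum (qterm u)) n
   + series (pairsum (qterm v)) n)).
  by apply: cvgD; [apply: cvgZl_tmp; exact: qsum_cvg|exact: qsum_cvg].
apply/funext => n; rewrite /series/= scaler_sumr -big_split/=; apply: eq_bigr => k _.
have qD i : qterm (c *: u + v) i = c *: qterm u i + qterm v i.
  by rewrite /qterm l2_DE l2_ZE scalerDr !scalerA [c * _]mulrC.
by rewrite /pairsum !qD scalerDr addrACA.
Qed.

Lemma qmapD u v : qmap (u + v) = qmap u + qmap v.
Proof. by have := qmap_linear 1 u v; rewrite !scale1r. Qed.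

Lemma qmap0 : qmap 0 = 0.
Proof.
have := qmapD 0 0; rewrite addr0 => /esym/eqP.
by rewrite -subr_eq0 addrK => /eqP.
Qed.

Lemma qmapZ (c : R[i]) u : qmap (c *: u) = c *: qmap u.
Proof. by have := qmap_linear c u 0; rewrite !addr0 qmap0 addr0. Qed.

Lemma qmapB u v : qmap (u - v) = qmap u - qmap v.
Proof. by rewrite qmapD -scaleN1r qmapZ scaleN1r. Qed.

Lemma qmap_le u : rnorm (qmap u) <= 2^-1 * (total (fun i => coef 0 i ^+ 2) + sqnorm u).
Proof.
have -> : 2^-1 * (total (fun i => coef 0 i ^+ 2) + sqnorm u) = qbound u.
  rewrite /qbound totalZ ?totalD//; first exact: amp_node_summable.
    exact: l2_summable.
  by apply: summableD; [exact: amp_node_summable|exact: l2_summable].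
have h : rnorm (series (pairsum (qterm u)) n) @[n --> \oo] --> rnorm (qmap u).
  by apply: cvg_rnorm; exact: (@qsum_cvg u).
apply: (cvgr_to_le h); apply: nearW => n.
have p := @partial_le_total R (fun i => 2^-1 * (coef 0 i ^+ 2 + sqnorms u i)) n
  (@qbound_term_ge0 u) (@qbound_summable u).
apply: le_trans p.
apply: le_trans (rnorm_sum _ _ _) _.
by apply: ler_sum => k _; exact: pair_qterm_le.
Qed.

(** The bound [qmap_le] on the unit ball extends by homogeneity. *)
Lemma qmap_bounded : exists2 C, 0 < C & forall u, rnorm (qmap u) <= C * rnorm u.
Proof.
pose A := total (fun i => coef 0 i ^+ 2) : R.
have A0 : 0 <= A.
  by apply: total_ge0; [move=> i; exact: sqr_ge0|exact: amp_node_summable].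
exists (2^-1 * (A + 1)); first by rewrite mulr_gt0// ltr_wpDl.
move=> u; have [u0|u0] := eqVneq (rnorm u) 0.
  by rewrite (rnorm0_eq0 u0) qmap0 !rnorm0 mulr0.
have r0 : 0 < rnorm u by rewrite lt_def u0 rnorm_ge0.
have n1 : sqnorm (((rnorm u)^-1)%:C *: u) = 1.
  by rewrite -l2_rnorm_sq rnormZr ger0_norm ?invr_ge0 ?rnorm_ge0// mulVf// expr1n.
have := qmap_le (((rnorm u)^-1)%:C *: u); rewrite n1 qmapZ rnormZr.
by rewrite ger0_norm ?invr_ge0 ?rnorm_ge0// ler_pdivrMl// mulrC.
Qed.

Lemma qmap_cvg (T : Type) (F : set_system T) (FF : Filter F) (f : T -> l2 H) u :
  f @ F --> u -> qmap (f t) @[t --> F] --> qmap u.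
Proof.
move=> /cvg_rnormP fu; apply/cvg_rnormP => e e0.
have [C C0 qC] := qmap_bounded.
have := fu (e / C); rewrite divr_gt0// => /(_ isT); apply: filterS => t.
by rewrite ltr_pdivlMr// mulrC -qmapB; apply: le_lt_trans; exact: qC.
Qed.

Lemma series_scale_cvg (c : nat * bool -> R[i]) x : csummable c ->
  series (pairsum (fun i => c i *: x)) @ \oo --> ctotal c *: x.
Proof.
move=> [cr ci].
rewrite (_ : series _ = (fun n =>
   (series (pairsum (fun i => complex.Re (c i))) n)%:C *: x +
   (series (pairsum (fun i => complex.Im (c i))) n)%:C *: ('i%C *: x))); last first.
  apply/funext => n; rewrite scalerA -scalerDl /series/=.
  rewrite !rmorph_sum/= mulr_suml -big_split/= scaler_suml; apply: eq_bigr => k _.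
  rewrite /pairsum -scalerDl; congr (_ *: _).
  case: (c (k, true)) (c (k, false)) => [a b] [a' b'].
  by apply/eqP; rewrite eq_complex/=; apply/andP; split; apply/eqP; ring.
rewrite [ctotal c]complexE scalerDl [X in _ + X](_ : _ =
  (total (fun i => complex.Im (c i)))%:C *: ('i%C *: x)); last first.
  by rewrite scalerA mulrC.
by apply: cvgD; apply: cvgZ_real => //; exact: cvg_cst.
Qed.

(** The moments of the conjugate weights are the powers of i. *)
Lemma qmap_embed k x : qmap (embed k x) = 'i%C ^+ k *: x.
Proof.
apply: cvg_lim; first exact: norm_hausdorff.
have e i : qterm (embed k x) i = (weight i * (node i ^+ k)%:C)^*%C *: x.
  rewrite /qterm embedE scalerA; congr (_ *: _); rewrite -phase_amp /coef.
  move: (amp i) (node i ^+ k) => a b; case: (phase i) => c d.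
  by apply/eqP; rewrite eq_complex/=; apply/andP; split; apply/eqP; ring.
rewrite (_ : pairsum _ = pairsum (fun i => (weight i * (node i ^+ k)%:C)^*%C *: x)); last first.
  by congr pairsum; apply/funext => i; exact: e.
have s := weight_csummable (R := R) k.
have -> : 'i%C ^+ k = ctotal (fun i => (weight i * (node i ^+ k)%:C)^*%C) :> R[i].
  rewrite ctotal_conj// weight_moment.
  rewrite (rmorphXn (conjc : {rmorphism R[i] -> R[i]})); congr (_ ^+ k).
  by apply/eqP; rewrite eq_complex/= oppr0 opprK !eqxx.
apply: series_scale_cvg; case: s => sr si; split.
  by apply: (summable_ext _ sr) => i; case: (weight i * _).
have := summableZ (-1) si; apply: summable_ext => i.
by case: (weight i * _) => a b /=; rewrite mulN1r.
Qed.

End QuotientMap.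

(** * The invariant domain *)

Section TranslationBound.
Context {R : realType} {E : hilbert R} (pi : axb R -> E -> E).
Context (hpi : unitary_rep pi).
Implicit Types u v w a c : E.

Lemma transop_iter_le (m : nat) h w :
  rnorm (transop pi (m%:R * h) w - w) <= m%:R * rnorm (transop pi h w - w).
Proof.
elim: m => [|m IH]; first by rewrite !mul0r (transop0 hpi) subrr rnorm0.
rewrite -natr1 !mulrDl !mul1r [_ + h]addrC (transopD hpi).
rewrite (_ : _ - w = transop pi h (transop pi (m%:R * h) w - w) + (transop pi h w - w)).
  by rewrite (le_trans (rnormD _ _))// lerD2r /transop (rep_rnorm hpi).
by rewrite /transop (repB hpi) addrA subrK.
Qed.

Lemma harmonic_dnbhs : @harmonic R @ \oo --> (0 : R)^'.
Proof.
move=> A A0.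
have : \forall m \near \oo, harmonic m != 0 :> R -> A (harmonic m) by exact: (@cvg_harmonic R _ A0).
by apply: filterS => m; apply; rewrite /harmonic/= invr_eq0 pnatr_eq0.
Qed.

(** The increment over a time t is at most m times the one over t / m; let m
    tend to infinity. *)
Lemma transop_lipschitz t w a : genA pi w a ->
  rnorm (transop pi t w - w) <= `|t| * rnorm a.
Proof.
move=> wa; have [->|t0] := eqVneq t 0.
  by rewrite (transop0 hpi) subrr rnorm0 normr0 mul0r.
pose q (h : R) := (h%:C)^-1 *: (transop pi h w - w).
have qa : q (t * harmonic m) @[m --> \oo] --> a.
  apply: (@cvg_comp _ _ _ (fun m => t * harmonic m) q _ _ _ _ wa).
  exact: (@cvg_comp _ _ _ (@harmonic R) (fun h => t * h) _ _ _ harmonic_dnbhs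
    (cvg_dnbhs0_scale t0)).
have c : `|t| * rnorm (q (t * harmonic m)) @[m --> \oo] --> `|t| * rnorm a.
  by apply: cvgMr; apply: cvg_rnorm; exact: qa.
apply: (cvgr_to_ge c); apply: nearW => m.
have := transop_iter_le m.+1 (t * harmonic m) w.
rewrite /q -fmorphV rnormZr [m.+1%:R * (t * _)]mulrCA /harmonic/= divff ?pnatr_eq0// mulr1.
move/le_trans; apply; rewrite mulrA -normrM invfM invrK mulrA divff// mul1r.
by rewrite ger0_norm.
Qed.

Lemma dpiE (X : R * R) v a c : genA pi v a -> genC pi v c ->
  dpi pi X v = X.1%:C *: a + X.2%:C *: c.
Proof. by move=> va vc; apply: cvg_lim; [exact: norm_hausdorff|exact: orbit_quot_cvg]. Qed.

End TranslationBound.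

Section Closure.
Context {R : realType} {E : hilbert R}.
Implicit Types (S : set E) (v w : E).

Lemma closureP S v :
  closure S v <-> forall e, 0 < e -> exists2 w, S w & rnorm (w - v) < e.
Proof.
split=> [cv e e0|h B /nbhs_ballP[[e c]/=]].
  have [|w [Sw]] := cv (ball v e%:C).
    by apply: nbhsx_ballx; rewrite ltcR.
  by rewrite -ball_normE/= rnormE ltcR rnormB; exists w.
rewrite ltcE/= => /andP[/eqP-> e0] eB; have [w Sw we] := h e e0.
by exists w; split=> //; apply: eB; rewrite -ball_normE/= rnormE ltcR rnormB.
Qed.

Lemma closure_subspace S : is_subspace S -> is_subspace (closure S).
Proof.
move=> [S0 SD]; split; first exact: subset_closure.
move=> c v w /closureP cv /closureP cw; apply/closureP => e e0.
have k0 : 0 <= complex.Re `|c| :> R by apply: le_trans (Re_le_norm c); exact: normr_ge0.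
have [v' Sv' vv'] := cv (e / (2 * (complex.Re `|c| + 1)))
  ltac:(by rewrite divr_gt0// mulr_gt0// ltr_wpDl).
have [w' Sw' ww'] := cw (e / 2) ltac:(by rewrite divr_gt0).
exists (c *: v' + w'); first exact: SD.
rewrite opprD addrACA -scalerBr (le_lt_trans (rnormD _ _))// rnormZ.
rewrite (splitr e) ler_ltD//.
move: vv'; rewrite ltr_pdivlMr ?mulr_gt0 ?ltr_wpDl//.
by have := rnorm_ge0 (v' - v); move: (complex.Re _) (rnorm _) k0 => k r; nra.
Qed.

End Closure.

Section Realization.
Context {R : realType} {H : hilbert R} (pic : axb R -> H -> H).
Context (hpic : unitary_rep pic).
Let E : hilbert R := l2_hilbert H.
Let pi : axb R -> E -> E := ampl hpic.
Implicit Types (x y a c : H) (u v w : E).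

Lemma coefS k i : coef k.+1 i = node i * coef k i :> R.
Proof. by rewrite /coef exprS; ring. Qed.

(** The difference quotients converge in each coordinate, and the Lipschitz
    bound on the orbit of x dominates them by the square summable family
    [coef k.+1]. *)
Lemma genA_embed k x a : genA pic x a -> genA pi (embed k x) (embed k.+1 a).
Proof.
move=> xa.
have xa' i : genA pic ((coef k i)%:C *: x) ((coef k i)%:C *: a).
  by have := genA_ZD hpic (coef k i)%:C xa (genA0 hpic); rewrite !addr0.
apply: (@l2_dominated R H _ ((0 : R)^') _ _ _
    (fun i => (4 * rnorm a ^+ 2) * coef k.+1 i ^+ 2)) => [t i||i].
- rewrite (_ : 4 * _ * _ = (2 * (`|coef k.+1 i| * rnorm a)) ^+ 2); last first.
    move: (coef _ _) (rnorm a) => r b.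
    by rewrite exprMn [(`|r| * b) ^+ 2]exprMn real_normK ?num_real//; ring.
  rewrite lerXn2r ?nnegrE ?mulr_ge0 ?rnorm_ge0//.
  rewrite l2_ZE l2_BE amplE !embedE (le_trans (ler_rnormB _ _))//.
  rewrite -fmorphV !rnormZr (_ : 2 * _ = `|coef k.+1 i| * rnorm a + `|coef k.+1 i| * rnorm a); last by ring.
  rewrite lerD2r.
  have := transop_lipschitz hpic (node i * t) (xa' i).
  rewrite /transop rnormZr => /(ler_wpM2l (normr_ge0 t^-1)) /le_trans; apply.
  rewrite coefS; move: (coef k i) => r; rewrite !mulrA -!normrM ler_wpM2r ?rnorm_ge0//.
  have [->|t0] := eqVneq t 0; first by rewrite !mulr0 mul0r normr0.
  by rewrite [t^-1 * _]mulrCA mulVf// mulr1.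
- by apply: summableZ; exact: amp_node_summable.
rewrite embedE coefS rmorphM -scalerA.
apply: (@quot_comp _ _ (fun h => transop pic h ((coef k i)%:C *: x) - (coef k i)%:C *: x)
  (fun t => node i * t) _ (node i)).
- by rewrite (transop0 hpic) subrr.
- exact: xa'.
apply: cvg_near_cst; near=> s.
have s0 : s != 0 by near: s; exact: near_dnbhs0_neq.
by rewrite mulrCA mulVf// mulr1.
Unshelve. all: by end_near. Qed.

Lemma ampl_dil_embed (b : {posnum R}) k x :
  pi (Axb 0 b) (embed k x) = embed k (pic (Axb 0 b) x).
Proof.
apply: l2_eq => i; rewrite amplE !embedE (repZ hpic); congr (_ *: pic _ x).
by apply: axb_eq => //=; rewrite mulr0.
Qed.

Lemma genC_embed k x c : genC pic x c -> genC pi (embed k x) (embed k c).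
Proof.
move=> xc; rewrite /genC (_ : (fun s => _) = (fun s : R =>
    embed k ((s%:C)^-1 *: (dilop pic s x - x)))); first exact: embed_cvg.
apply/funext => s; rewrite /dilop /axb_chart/= ampl_dil_embed.
apply: l2_eq => i; rewrite l2_ZE l2_BE !embedE -scalerBr !scalerA.
by rewrite mulrC.
Qed.

(** The linear span of the vectors [embed k x] for x in the core, as an
    intersection of subspaces: membership is an induction principle. *)
Definition dom : set E := [set u | forall S : set E, is_subspace S ->
  (forall k x, core pic x -> S (embed k x)) -> S u].

Lemma dom_embed k x : core pic x -> dom (embed k x).
Proof. by move=> cx S _; exact. Qed.

Lemma dom_subspace : is_subspace dom.
Proof.
split=> [S [S0 _] _ //|c u v du dv S sS eS].
by have [_ SD] := sS; apply: SD; [exact: du|exact: dv].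
Qed.

(** The canonical map intertwines the generator of the translations of the
    amplified representation with i times that of [pic], and the generators of
    the dilations with each other: this is the passage to the dual group. *)
Definition intertwined : set E := [set u | exists a c : E, [/\ genA pi u a, genC pi u c,
  dom a, dom c & [/\ core pic (qmap u), genA pic (qmap u) (- 'i%C *: qmap a) &
  genC pic (qmap u) (qmap c)]]].

Lemma dom_intertwined : dom `<=` intertwined.
Proof.
move=> u; apply=> [|k x cx]; first split.
- have d0 : dom 0 by have [] := dom_subspace.
  have [c0 _] := core_subspace hpic.
  exists 0, 0; split=> //; [exact: genA0 (ampl_rep hpic)|exact: genC0 (ampl_rep hpic)|].
  by rewrite qmap0 scaler0; split=> //; [exact: genA0|exact: genC0].
- move=> z {}u v [a [c [ua uc da dc [qu qa qc]]]] [a' [c' [va vc da' dc' [qv qa' qc']]]].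
  have [_ dD] := dom_subspace; have [_ cD] := core_subspace hpic.
  exists (z *: a + a'), (z *: c + c'); split.
  + exact: genA_ZD (ampl_rep hpic) _ _ _ _ _ ua va.
  + exact: genC_ZD (ampl_rep hpic) _ _ _ _ _ uc vc.
  + exact: dD.
  + exact: dD.
  + rewrite !qmap_linear; split; first exact: cD.
      by rewrite scalerDr scalerA mulrC -scalerA; exact: genA_ZD.
    exact: genC_ZD.
have [a xa ca] := core_genA cx; have [c xc cc] := core_genC cx.
exists (embed k.+1 a), (embed k c); split.
- exact: genA_embed.
- exact: genC_embed.
- exact: dom_embed.
- exact: dom_embed.
rewrite !qmap_embed; have [c0 cD] := core_subspace hpic; split.
- by have := cD ('i%C ^+ k) _ _ cx c0; rewrite addr0.
- have := genA_ZD hpic ('i%C ^+ k) xa (genA0 hpic); rewrite !addr0 scalerA exprS mulrA.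
  by rewrite mulNr -expr2 sqr_i opprK mul1r.
by have := genC_ZD hpic ('i%C ^+ k) xc (genC0 hpic); rewrite !addr0.
Qed.

End Realization.

(** * Reflection positivity *)

Section ReflectionPositivity.
Context {R : realType} {H : hilbert R} (pic : axb R -> H -> H).
Context (hpic : unitary_rep pic).
Let E : hilbert R := l2_hilbert H.
Local Notation pi := (ampl hpic).
Local Notation D := (dom pic).
Implicit Types (x y a c : H) (u v w : E).

(** The (j+k)-th moment of the weights is (-i)^(j+k), and the reflection
    contributes (-1)^j: the product is i^j times the conjugate of i^k. *)
Lemma pairing_embed j k x y :
  inner E (theta (embed j x)) (embed k y) = inner H ('i%C ^+ j *: x) ('i%C ^+ k *: y).
Proof.
have e i : inner H ((theta (embed j x) : l2 H) i) ((embed k y : l2 H) i) =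
    ((-1) ^+ j * inner H x y) * (weight i * (node i ^+ (j + k))%:C).
  rewrite thetaE !embedE scalerA innerZl innerZr conjc_real -phase_amp /coef.
  rewrite amp_flip node_flip [(- node i) ^+ j]exprNn exprD expr2 !(rmorphM (real_complex R)).
  rewrite [X in _ * (_ * (X * _))](_ : _ = (-1) ^+ j); first by ring.
  by rewrite rmorphXn rmorphN1.
rewrite [LHS](ctotal_ext e) ctotalZ; last exact: weight_csummable.
rewrite weight_moment exprD innerZl innerZr (rmorphXn (conjc : {rmorphism R[i] -> R[i]})).
rewrite [X in _ = _ * (X ^+ _ * _)](_ : _ = - 'i%C); last first.
  by apply/eqP; rewrite eq_complex/= oppr0 !eqxx.
have -> : 'i%C ^+ j = (-1) ^+ j * (- 'i%C) ^+ j :> R[i] by rewrite -exprMn mulN1r opprK.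
by ring.
Qed.

Lemma theta0 : theta (0 : E) = 0 :> E.
Proof. by apply: l2_eq => i; rewrite thetaE scaler0. Qed.

Lemma pairing_dom u v : D u -> D v ->
  inner E (theta u) v = inner H (qmap u) (qmap v).
Proof.
move=> du dv; apply: (du [set u | inner E (theta u) v = inner H (qmap u) (qmap v)]).
  rewrite /mkset; split=> [|z u' w uv wv]; first by rewrite theta0 qmap0 !linear0l.
  by rewrite theta_linear qmap_linear !innerDl !innerZl uv wv.
move=> j x _; apply: (dv [set v | inner E (theta (embed j x)) v =
    inner H (qmap (embed j x)) (qmap v)]).
  rewrite /mkset; split=> [|z v' w xv xw]; first by rewrite qmap0 !linear0r.
  by rewrite qmap_linear !innerDr !innerZr xv xw.
by move=> k y _; rewrite /mkset !qmap_embed pairing_embed.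
Qed.

Lemma theta_rnorm u : rnorm (theta u : E) = rnorm u.
Proof.
apply/eqP; rewrite -(@eqrXn2 _ 2) ?rnorm_ge0//; apply/eqP/(@complexI R).
by rewrite -!inner_rnorm; have [_ -> _] := @theta_unitary R H.
Qed.

(** The reflection is self-adjoint, so that the form is real; polarization
    expresses it by norms, which are continuous. *)
Lemma theta_form u :
  inner E (theta u) u = (2^-1 * rnorm (theta u + u : E) ^+ 2 - rnorm u ^+ 2)%:C.
Proof.
have sym : inner E (theta u) u = (inner E (theta u) u)^*%C.
  rewrite -inner_conj; have [_ <- _] := @theta_unitary R H.
  by rewrite thetaK.
have := Re_inner (theta u : E) u; rewrite theta_rnorm.
move: sym; case: (inner E _ _) => p q /eqP; rewrite eq_complex/= => /andP[_ /eqP qN] ->.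
apply/eqP; rewrite eq_complex/=; apply/andP; split; apply/eqP; last by lra.
by rewrite -mulr_natr; field.
Qed.

Lemma theta_cvg (T : Type) (F : set_system T) (FF : Filter F) (f : T -> E) u :
  f @ F --> u -> (theta (f t) : E) @[t --> F] --> (theta u : E).
Proof.
move=> /cvg_rnormP Fu; apply/cvg_rnormP => e /Fu; apply: filterS => t.
have -> : theta (f t) - theta u = theta (f t - u) :> E.
  by rewrite -scaleN1r addrC -theta_linear scaleN1r addrC.
by rewrite theta_rnorm.
Qed.

(** The equality passes from the domain to its closure by continuity. *)
Lemma pairing_closure u : closure D u ->
  inner E (theta u) u = (rnorm (qmap u) ^+ 2)%:C.
Proof.
pose f u := 2^-1 * rnorm (theta u + u : E) ^+ 2 - rnorm u ^+ 2 - rnorm (qmap u) ^+ 2.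
have fc : continuous f.
  move=> v; have FF : Filter (nbhs v) by exact: nbhs_filter.
  have vv : id @ nbhs v --> v by exact: cvg_id.
  have tc : (theta w + w : E) @[w --> v] --> (theta v + v : E).
    have t0 := @theta_cvg E (nbhs v) FF id v vv.
    exact: (@cvgD _ E _ (nbhs v) FF (fun w => theta w : E) id _ _ t0 vv).
  have qc : qmap w @[w --> v] --> qmap v by exact: (@qmap_cvg _ _ _ (nbhs v) FF id v vv).
  have c1 := cvg_sqr FF (cvg_rnorm FF tc).
  have c2 := cvg_sqr FF (cvg_rnorm FF vv).
  have c3 := cvg_sqr FF (cvg_rnorm FF qc).
  have c4 : 2^-1 * rnorm (theta w + w : E) ^+ 2 @[w --> v] -->
    2^-1 * rnorm (theta v + v : E) ^+ 2 by apply: cvgMr; exact: c1.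
  exact: (@cvgB _ _ _ _ _ _ _ _ _ (@cvgB _ _ _ _ _ _ _ _ _ c4 c2) c3).
have f0 : closed (f @^-1` [set 0]).
  by apply: closed_comp; [move=> v _; exact: fc|exact: closed_eq].
move=> cu; rewrite theta_form; congr (_%:C); apply/eqP; rewrite -subr_eq0; apply/eqP.
apply: (f0 u); apply: (closure_subset _ cu) => v dv.
have := pairing_dom dv dv; rewrite theta_form inner_rnorm => /(@complexI R) h.
by rewrite /preimage /mkset /f h subrr.
Qed.

(** The dilations act on all coordinates alike. *)
Lemma qmap_dil (b : {posnum R}) u :
  pic (Axb 0 b) (qmap u) = qmap (pi (Axb 0 b) u).
Proof.
apply/esym/cvg_lim; first exact: norm_hausdorff.
rewrite (_ : series _ = (fun n => pic (Axb 0 b) (series (pairsum (qterm u)) n))).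
  exact: (rep_continuous hpic (Axb 0 b) (@qsum_cvg _ _ u)).
apply/funext => n; rewrite /series/= (big_morph _ (repD hpic (Axb 0 b)) (rep0 hpic (Axb 0 b))).
apply: eq_bigr => k _; rewrite /pairsum (repD hpic) /qterm !(repZ hpic) !amplE.
by congr (_ *: pic _ _ + _ *: pic _ _); apply: axb_eq => //=; rewrite mulr0.
Qed.

Lemma dom_dil (b : {posnum R}) u : D u -> D (pi (Axb 0 b) u).
Proof.
move=> du; apply: (du [set u | D (pi (Axb 0 b) u)]).
  have [d0 dD] := dom_subspace pic; rewrite /mkset.
  split=> [|z u' v uu vv]; first by rewrite (rep0 (ampl_rep hpic)).
  by rewrite (rep_linear (ampl_rep hpic)); exact: dD.
move=> k x cx; rewrite /mkset ampl_dil_embed; apply: dom_embed.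
rewrite (_ : Axb 0 b = axb_chart (0, ln b%:num)); first exact: core_dilop.
by apply: axb_eq => //=; rewrite lnK// posrE.
Qed.

Lemma closure_dil (b : {posnum R}) u : closure D u -> closure D (pi (Axb 0 b) u).
Proof.
move=> /closureP cu; apply/closureP => e /cu[w dw wu].
exists (pi (Axb 0 b) w); first exact: dom_dil.
by rewrite -(repB (ampl_rep hpic)) (rep_rnorm (ampl_rep hpic)).
Qed.

Lemma ampl_RP2 : RP2 (closure D) pi.
Proof.
move=> b; apply/seteqP; split=> [_ [u cu <-]|u cu]; first exact: closure_dil.
exists (pi (Axb 0 (b%:num^-1)%:pos) u); first exact: closure_dil.
rewrite (rep_mul (ampl_rep hpic)) -[RHS](rep_one (ampl_rep hpic)); congr (pi _ u).
by apply: axb_eq => /=; rewrite ?mulr0 ?addr0// mulfV ?gt_eqF.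
Qed.

Lemma dom_smooth : D `<=` smooth_vector pi.
Proof.
apply: (invariant_smooth (ampl_rep hpic)); first exact: dom_subspace.
- by move=> u /(dom_intertwined hpic)[a [c [ua _ da _ _]]]; exists a.
- by move=> u /(dom_intertwined hpic)[a [c [_ uc _ dc _]]]; exists c.
Qed.

Lemma ampl_RP3 : RP3 (closure D) pi D.
Proof.
split=> //.
- exact: dom_subspace.
- by move=> u du; split; [exact: subset_closure|exact: dom_smooth].
move=> t u /(dom_intertwined hpic)[a [c [ua uc da dc _]]].
rewrite (dpiE (ampl_rep hpic) _ ua uc)/=; have [d0 dD] := dom_subspace pic.
by apply: dD => //; rewrite scale0r.
Qed.

Lemma qmap_completion : is_hilbert_completion (closure D) theta qmap.
Proof.
split=> [z u v _ _|u cu|O [x Ox] oO]; first exact: qmap_linear.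
  by rewrite pairing_closure// rmorphXn/= -rnormE sqrCK.
have /nbhs_ballP[[e c]/=] := open_nbhs_nbhs (conj oO Ox).
rewrite ltcE/= => /andP[/eqP-> e0] eO.
have [w cw wx] := core_dense hpic x e0.
exists w; split; first by apply: eO; rewrite -ball_normE/= rnormE ltcR rnormB.
exists (embed 0 w); first by apply: subset_closure; exact: dom_embed.
by rewrite qmap_embed expr0 scale1r.
Qed.

Lemma pic_integrates : integrates_to (closure D) D qmap pi pic.
Proof.
split=> //.
- move=> u /(dom_intertwined hpic)[a [c [_ _ _ _ [cu _ _]]]].
  apply: (invariant_smooth hpic (core_subspace hpic)) => // v cv.
    exact: core_genA.
  exact: core_genC.
- move=> [t s] u /(dom_intertwined hpic)[a [c [ua uc _ _ [_ qa qc]]]].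
  rewrite /beta (dpiE hpic _ qa qc) !(dpiE (ampl_rep hpic) _ ua uc)/=.
  rewrite !scale0r add0r addr0 !qmapZ !scalerA addrC; congr (_ + _).
  by rewrite mulrN mulrC scaleNr.
by move=> b u _; exact: qmap_dil.
Qed.

End ReflectionPositivity.

Theorem proposition5p8 (R : realType) (H : hilbert R) (pic : axb R -> H -> H)
    (hpic : unitary_rep pic) (hpos : positive_energy pic) :
  has_euclidean_realization pic.
Proof.
exists (l2_hilbert H), (closure (dom pic)), theta, (ampl hpic), (dom pic); split.
  split.
  - split; [exact: theta_unitary|exact: thetaK| |exact: closed_closure|].
      by apply: closure_subspace; exact: dom_subspace.
    by move=> u cu; rewrite (pairing_closure cu) lecR sqr_ge0.
  - exact: ampl_rep.
  - exact: ampl_RP1.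
  - exact: ampl_RP2.
  - exact: ampl_RP3.
exists H, qmap, pic; split; [exact: qmap_completion|exact: pic_integrates|].
exists id => //; split=> // w; by exists w.
Qed.
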